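(* Let $n > 0$ be an integer. Each of the following graphs belongs to $\mathcal{O}_n$: (i) the complete graph $K_{n+5}$, its (up to isomorphism unique) child, and the children of that child; (ii) the graph $K_{3^2,1^n}$ and each of its children.
   Context: All graphs are finite. A graph is $n$-apex if deleting $n$ or fewer of its vertices can result in a planar graph. $H$ is a minor of $G$ if $H$ can be obtained by contracting edges in a subgraph of $G$. $\mathcal{O}_n$ is the set of graphs that are not $n$-apex even though every proper minor is $n$-apex. $K_{3^2,1^n}$ is the complete multipartite graph with two parts of three vertices each and $n$ further parts each having a single vertex. A $\nabla\mathrm{Y}$ move on a graph deletes the three edges of a triangle $abc$ and then adds a new vertex $v$ together with the edges $av$, $bv$, $cv$. A child of a graph $G$ is a graph obtained from $G$ by a single $\nabla\mathrm{Y}$ move. Up to isomorphism, $K_{n+5}$ has one child, and that child has two children. For $n \ge 3$, $K_{3^2,1^n}$ has three children up to isomorphism, obtained by $\nabla\mathrm{Y}$ moves on a triangle containing respectively one, two, or three vertices from the singleton parts. *)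

(* Defs.v *)
From HB Require Import structures.
From mathcomp Require Import all_boot all_order all_algebra.
From mathcomp Require Import boolp classical_sets set_interval reals topology
  normedtype.

Set Implicit Arguments.
Unset Strict Implicit.
Unset Printing Implicit Defensive.

Import Order.TTheory GRing.Theory Num.Theory.
Import numFieldNormedType.Exports.

(** * Finite simple graphs *)

Record sgraph := SGraph {
  vertex :> finType;
  adj : rel vertex;
  adj_sym : symmetric adj;
  adj_irrefl : irreflexive adj }.

Definition isomorphic (G H : sgraph) : Prop :=
  exists2 f : G -> H, bijective f & forall x y, adj (f x) (f y) = adj x y.

Definition subgraph (H G : sgraph) : Prop :=
  exists2 f : H -> G, injective f & forall x y, adj x y -> adj (f x) (f y).

(** ** Vertex deletion *)

Section DeleteVertices.
Variables (G : sgraph) (S : {set G}).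

Definition delete_adj : rel {x : G | x \notin S} :=
  fun u v => adj (val u) (val v).

Lemma delete_adj_sym : symmetric delete_adj.
Proof. by move=> u v; rewrite /delete_adj adj_sym. Qed.

Lemma delete_adj_irrefl : irreflexive delete_adj.
Proof. by move=> u; rewrite /delete_adj adj_irrefl. Qed.

Definition delete_vertices : sgraph := SGraph delete_adj_sym delete_adj_irrefl.

End DeleteVertices.

(** ** Minors *)

(* Contraction of the edge [xy]: the vertex [y] is merged into [x]; parallel
   edges are identified and no loop is kept.  Only meaningful when [adj x y]. *)
Section ContractEdge.
Variables (G : sgraph) (x y : G).

Definition contract_adj : rel {z : G | z != y} := fun u v =>
  (u != v) && [|| adj (val u) (val v),
                  (val u == x) && adj y (val v)
                | (val v == x) && adj y (val u)].

Lemma contract_adj_sym : symmetric contract_adj.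
Proof.
by move=> u v; rewrite /contract_adj eq_sym adj_sym; congr (_ && (_ || _));
  rewrite orbC.
Qed.

Lemma contract_adj_irrefl : irreflexive contract_adj.
Proof. by move=> u; rewrite /contract_adj eqxx. Qed.

Definition contract_edge : sgraph :=
  SGraph contract_adj_sym contract_adj_irrefl.

End ContractEdge.

Inductive contraction (G : sgraph) : sgraph -> Prop :=
| contraction_refl : contraction G G
| contraction_step (H : sgraph) (x y : H) :
    contraction G H -> adj x y -> contraction G (contract_edge x y).

Definition minor (H G : sgraph) : Prop :=
  exists S C : sgraph, [/\ subgraph S G, contraction S C & isomorphic H C].

Definition proper_minor (H G : sgraph) : Prop :=
  minor H G /\ ~ isomorphic H G.

(** ** Triangle-Y moves *)

(* [None] is the new vertex. Only meaningful when [a], [b], [c] form a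
   triangle. *)
Section NablaY.
Variables (G : sgraph) (a b c : G).

Definition nablaY_adj : rel (option G) := fun u v =>
  match u, v with
  | Some x, Some y =>
      adj x y && ~~ ((x \in [:: a; b; c]) && (y \in [:: a; b; c]))
  | Some x, None | None, Some x => x \in [:: a; b; c]
  | None, None => false
  end.

Lemma nablaY_adj_sym : symmetric nablaY_adj.
Proof. by move=> [x|] [y|] //=; rewrite adj_sym [X in ~~ X]andbC. Qed.

Lemma nablaY_adj_irrefl : irreflexive nablaY_adj.
Proof. by move=> [x|] //=; rewrite adj_irrefl. Qed.

Definition nablaY : sgraph := SGraph nablaY_adj_sym nablaY_adj_irrefl.

End NablaY.

Definition child (H G : sgraph) : Prop :=
  exists a b c : G,
    [/\ adj a b, adj b c, adj a c & isomorphic H (nablaY a b c)].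

(** ** Complete and complete multipartite graphs *)

Section Complete.
Variable m : nat.

Definition complete_adj : rel 'I_m := fun i j => i != j.

Lemma complete_adj_sym : symmetric complete_adj.
Proof. by move=> i j; rewrite /complete_adj eq_sym. Qed.

Lemma complete_adj_irrefl : irreflexive complete_adj.
Proof. by move=> i; rewrite /complete_adj eqxx. Qed.

Definition complete_graph : sgraph :=
  SGraph complete_adj_sym complete_adj_irrefl.

End Complete.

Section CompleteMultipartite.
Variables (k : nat) (s : 'I_k -> nat).

Definition multipartite_adj : rel {i : 'I_k & 'I_(s i)} :=
  fun u v => tag u != tag v.

Lemma multipartite_adj_sym : symmetric multipartite_adj.
Proof. by move=> u v; rewrite /multipartite_adj eq_sym. Qed.

Lemma multipartite_adj_irrefl : irreflexive multipartite_adj.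
Proof. by move=> u; rewrite /multipartite_adj eqxx. Qed.

Definition complete_multipartite : sgraph :=
  SGraph multipartite_adj_sym multipartite_adj_irrefl.

End CompleteMultipartite.

(* $K_{3^2,1^n}$ *)
Definition K33_1 (n : nat) : sgraph :=
  complete_multipartite (fun i : 'I_(2 + n) => if i < 2 then 3 else 1).

(** * Planarity *)

Section Planarity.
Variable R : realType.
Local Open Scope classical_set_scope.
Local Open Scope ring_scope.

Definition is_arc (p q : R * R) (A : set (R * R)) : Prop :=
  exists g : R -> R * R,
    [/\ {within `[0, 1], continuous g}, {in `[0, 1] &, injective g},
        g @` `[0, 1] = A, g 0 = p & g 1 = q].

(* The last condition says that distinct edges meet only in vertices; by the
   one before it, such a vertex is an end of both edges. *)
Definition planar (G : sgraph) : Prop :=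
  exists (pos : G -> R * R) (edge : G -> G -> set (R * R)),
    [/\ injective pos,
        forall x y, adj x y ->
          edge x y = edge y x /\ is_arc (pos x) (pos y) (edge x y),
        forall x y z, adj x y -> edge x y (pos z) -> z = x \/ z = y
      & forall x y z w, adj x y -> adj z w ->
          (x, y) != (z, w) -> (x, y) != (w, z) ->
          edge x y `&` edge z w `<=` range pos].

End Planarity.

(** * Apex graphs *)

Definition n_apex (R : realType) (n : nat) (G : sgraph) : Prop :=
  exists2 S : {set G}, #|S| <= n & planar R (delete_vertices S).

Definition in_O (R : realType) (n : nat) (G : sgraph) : Prop :=
  ~ n_apex R n G /\ forall H : sgraph, proper_minor H G -> n_apex R n H.

(* Main.v *)
From mathcomp Require Import all_boot all_order all_algebra.
From mathcomp Require Import ring lra zify.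
From mathcomp Require Import boolp classical_sets set_interval interval_inference
  reals topology normedtype prodnormedzmodule.
Require Import Defs.

Set Implicit Arguments.
Unset Strict Implicit.
Unset Printing Implicit Defensive.

Import Order.TTheory GRing.Theory Num.Theory.
Import numFieldNormedType.Exports.

(** All graphs concerned have [n + k] vertices with [k] = 5, 6 or 7: [k] = 5 for
the complete graph, 6 for its child and for the multipartite graph, 7 for the
remaining ones. Apart from a bounded number of special vertices, all their
vertices are twins of each other, so that both halves of the claim reduce to
finite computations ([template_in_O]) on nine infinite graphs on the natural
numbers, whose initial segments are the graphs in question ([labelling]).

They are not [n]-apex: deleting [n] vertices leaves at least [k], and up to
exchange of twins there are finitely many possibilities for [k] survivors. Each
contains a subdivision of K5 or of K33 ([nonplanarity_test]). To see that these
cannot be drawn with continuous arcs, the arcs are replaced by fine polygons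
([planar_poly_drawing]): arcs of edges without a common end are disjoint and
compact, hence so are the polygons. Modulo two, the number of crossings of two
polygonal paths is a sum of terms that each involve one path and one end of the
other ([apart_parity]). Adding the resulting equations over all pairs of
independent edges of K5 or K33, all these terms cancel, and one is left with
1 = 0 ([odd_system_not_drawn]).

Their proper minors are [n]-apex: a graph on [n + k] vertices is [n]-apex as soon
as its complement contains the complement of a plane triangulation on [k]
vertices ([n_apex_pattern]), for then all other vertices can be deleted, and the
rest has an explicit straight-line drawing. On at most [n + 5] vertices this shows
that every graph except for the complete one on [n + 5] is [n]-apex
([n_apex_small]). A proper minor on all vertices is a subgraph that misses an
edge, a minor with one vertex less is a subgraph of the graph with one edge
contracted, and a minor that loses two vertices has at most [n + 5]
([minor_cases]); suitable triangulations are found by computation in the first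
two cases. It remains to exclude complete minors on [n + 5] vertices from the
graphs with [k] > 5. Such a minor has so many branch sets that most of them are
single vertices. These are pairwise adjacent of degree at least [n + 4]
([complete_minor_clique]), but the graphs contain too many nonadjacent vertices
or vertices of degree three. *)

(** * Crossings of segments modulo two *)

Section CrossingParity.
Local Open Scope ring_scope.
Variable R : realType.
Implicit Types a b p q r : R * R.

Definition segments_meet a b q r : Prop :=
  exists l m : R, [/\ 0 <= l <= 1, 0 <= m <= 1,
    (1 - l) * a.1 + l * b.1 = (1 - m) * q.1 + m * r.1 &
    (1 - l) * a.2 + l * b.2 = (1 - m) * q.2 + m * r.2].

Definition line_at a b (x : R) : R :=
  a.2 + (b.2 - a.2) * ((x - a.1) / (b.1 - a.1)).

Definition straddles a b p : bool := (a.1 < p.1) (+) (b.1 < p.1).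

Definition over a b p : bool := straddles a b p && (p.2 < line_at a b p.1).

Lemma line_at_sym a b x : a.1 != b.1 -> line_at a b x = line_at b a x.
Proof.
move=> ab; rewrite /line_at; field.
by rewrite !subr_eq0 ab eq_sym ab.
Qed.

Lemma over_sym a b p : a.1 != b.1 -> over a b p = over b a p.
Proof. by move=> ab; rewrite /over /straddles line_at_sym // addbC. Qed.

Lemma segments_meet_syml a b q r : segments_meet a b q r -> segments_meet b a q r.
Proof.
move=> [l [m [/andP[l0 l1] hm e1 e2]]]; exists (1 - l), m.
by split=> //; [lra | rewrite -e1; ring | rewrite -e2; ring].
Qed.

Lemma segments_meet_symr a b q r : segments_meet a b q r -> segments_meet a b r q.
Proof.
move=> [l [m [hl /andP[m0 m1] e1 e2]]]; exists l, (1 - m).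
by split=> //; [lra | rewrite e1; ring | rewrite e2; ring].
Qed.

Lemma line_atE a b : a.1 != b.1 ->
  exists u v, forall x, line_at a b x = u + v * x.
Proof.
move=> ab; exists (a.2 - (b.2 - a.2) / (b.1 - a.1) * a.1),
  ((b.2 - a.2) / (b.1 - a.1)).
by move=> y; rewrite /line_at; field; rewrite subr_eq0 eq_sym.
Qed.

Lemma meet_at a b q r x : a.1 < b.1 -> q.1 < r.1 ->
  a.1 <= x <= b.1 -> q.1 <= x <= r.1 -> line_at a b x = line_at q r x ->
  segments_meet a b q r.
Proof.
move=> ab qr /andP[ax xb] /andP[qx xr] e.
have ab0 : 0 < b.1 - a.1 by lra.
have qr0 : 0 < r.1 - q.1 by lra.
exists ((x - a.1) / (b.1 - a.1)), ((x - q.1) / (r.1 - q.1)); split.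
- by rewrite divr_ge0 ?ler_pdivrMr //; lra.
- by rewrite divr_ge0 ?ler_pdivrMr //; lra.
- by transitivity x; [|symmetry]; field; rewrite gt_eqF.
- transitivity (line_at a b x); first by rewrite /line_at; ring.
  by rewrite e /line_at; ring.
Qed.

(** The difference of the two heights is affine in the abscissa, so a change of
order would produce an abscissa at which the segments meet. *)
Lemma order_constant a b q r x y : a.1 < b.1 -> q.1 < r.1 ->
  ~ segments_meet a b q r ->
  a.1 <= x <= b.1 -> q.1 <= x <= r.1 -> a.1 <= y <= b.1 -> q.1 <= y <= r.1 ->
  (line_at q r x < line_at a b x) = (line_at q r y < line_at a b y).
Proof.
move=> ab qr nm; wlog: x y / line_at q r x < line_at a b x => [hw|].
  move=> ax qx ay qy.
  case hx: (line_at q r x < line_at a b x); first by rewrite -hx; apply: hw.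
  case hy: (line_at q r y < line_at a b y) => //.
  by have := hw y x hy ay qy ax qx; rewrite hx hy.
move=> hx; rewrite hx => ax qx ay qy; symmetry.
have [//|hy] := ltP; case: nm.
have [|u [v uv]] := @line_atE a b; first by rewrite lt_eqF.
have [|u' [v' uv']] := @line_atE q r; first by rewrite lt_eqF.
pose f z := line_at a b z - line_at q r z.
have fx : 0 < f x by rewrite /f subr_gt0.
have fy : f y <= 0 by rewrite /f subr_le0.
pose l := f x / (f x - f y).
have fxy : 0 < f x - f y by lra.
have l0 : 0 <= l by rewrite divr_ge0 //; lra.
have l1 : l <= 1 by rewrite ler_pdivrMr //; lra.
have bnd c d : c <= x <= d -> c <= y <= d -> c <= (1 - l) * x + l * y <= d.
  by move=> /andP[c1 c2] /andP[c3 c4]; apply/andP; split; nra.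
apply: (@meet_at _ _ _ _ ((1 - l) * x + l * y)) => //; try exact: bnd.
apply/eqP; rewrite -subr_eq0; apply/eqP.
transitivity ((1 - l) * f x + l * f y); first by rewrite /f !uv !uv'; ring.
by rewrite /l; field; rewrite gt_eqF.
Qed.

Lemma line_at_l a b : line_at a b a.1 = a.2.
Proof. by rewrite /line_at subrr mul0r mulr0 addr0. Qed.

Lemma line_at_r a b : a.1 != b.1 -> line_at a b b.1 = b.2.
Proof. by move=> ab; rewrite line_at_sym // line_at_l. Qed.

(** Distinct abscissas are all that the parity argument needs from general
position; a shear of the plane provides them. *)
Definition general_position a b q r : bool := uniq [:: a.1; b.1; q.1; r.1].

Definition under a b p : bool := straddles a b p && ~~ (p.2 < line_at a b p.1).

(** The parity of the number of crossings of two segments is a coboundary: it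
is a sum of terms that each involve one segment and one end of the other.
Indeed the common x-range of the two segments, if there is one, is bounded by
two of the four end points; each of these two contributes one term, which says
which segment is on top there, and by [order_constant] the two terms agree. *)
Lemma segment_parity a b q r :
  general_position a b q r -> ~ segments_meet a b q r ->
  over a b q (+) over a b r (+) (under q r a (+) under q r b) = false.
Proof.
have under_sym c d p : c.1 != d.1 -> under c d p = under d c p.
  by move=> cd; rewrite /under /straddles line_at_sym // addbC.
wlog ab : a b / a.1 < b.1 => [hw gp nm|].
  have [] := ltgtP a.1 b.1; first by move=> ab; exact: hw.
  - move=> ba; rewrite (@over_sym a b) ?gt_eqF // (@over_sym a b) ?gt_eqF //.
    rewrite (addbC (under q r a)); apply: hw => //.
      move: gp; rewrite /general_position /= !inE !negb_or.
      by rewrite (eq_sym b.1 a.1) => /and4P[/and3P[-> -> ->] /andP[-> ->] -> _].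
    by move/segments_meet_syml.
  - by move=> e; move: gp; rewrite /general_position /= e !inE eqxx.
wlog qr : q r / q.1 < r.1 => [hw gp nm|].
  have [] := ltgtP q.1 r.1; first by move=> ab'; exact: hw.
  - move=> rq; rewrite (@under_sym q r) ?gt_eqF // (@under_sym q r) ?gt_eqF //.
    rewrite (addbC (over a b q)); apply: hw => //.
      move: gp; rewrite /general_position /= !inE !negb_or (eq_sym r.1 q.1).
      by move=> /and4P[/and3P[-> -> ->] /andP[-> ->] -> _].
    by move/segments_meet_symr.
  - by move=> e; move: gp; rewrite /general_position /= e !inE eqxx !andbF.
rewrite /general_position /= !inE !negb_or.
move=> /and4P[/and3P[nab naq nar] /andP[nbq nbr] nqr _] nm.
have nab' : a.1 != b.1 by [].
have oc x y := order_constant (x := x) (y := y) ab qr nm.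
have ne x : a.1 <= x <= b.1 -> q.1 <= x <= r.1 ->
    ~~ (line_at a b x < line_at q r x) = (line_at q r x < line_at a b x).
  move=> hx hx'; rewrite -leNgt lt_neqAle; case: eqP => //= e.
  by case: nm; apply: (@meet_at _ _ _ _ x).
rewrite /over /under /straddles.
have -> : (q.2 < line_at a b q.1) = (line_at q r q.1 < line_at a b q.1).
  by rewrite (line_at_l q).
have -> : (r.2 < line_at a b r.1) = (line_at q r r.1 < line_at a b r.1).
  by rewrite (line_at_r nqr).
have -> : (a.2 < line_at q r a.1) = (line_at a b a.1 < line_at q r a.1).
  by rewrite (line_at_l a).
have -> : (b.2 < line_at q r b.1) = (line_at a b b.1 < line_at q r b.1).
  by rewrite (line_at_r nab').
case: (ltgtP a.1 q.1) naq => [aq|qa|_] // _; case: (ltgtP a.1 r.1) nar => [ar|ra|_] // _;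
  case: (ltgtP b.1 q.1) nbq => [bq|qb|_] // _; case: (ltgtP b.1 r.1) nbr => [br|rb|_] // _ //=;
  try (exfalso; lra).
all: rewrite ?ne ?addbF ?addFb; try (apply/andP; split; lra).
all: set c := line_at _ _ _ < _; set d := line_at _ _ _ < _.
all: suff ->: c = d by rewrite addbb.
all: apply: oc; apply/andP; split; lra.
Qed.

End CrossingParity.

(** * Polygonal drawings of K5 and K33 *)

Lemma xor_path_step (x1 x2 y1 y2 u v w s1 s2 s3 : bool) :
  x1 (+) x2 (+) (u (+) v) = s1 (+) s2 ->
  y1 (+) y2 (+) (v (+) w) = s2 (+) s3 ->
  x1 (+) y1 (+) (x2 (+) y2) (+) (u (+) w) = s1 (+) s3.
Proof. by move: x1 x2 y1 y2 u v w s1 s2 s3; do 10!case. Qed.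

Lemma xor_side_step (x1 x2 x3 u1 v1 u2 v2 s1 s2 t1 t2 : bool) :
  x1 (+) x2 (+) (u1 (+) s1 (+) (v1 (+) s2)) = false ->
  x2 (+) x3 (+) (u2 (+) v2) = t1 (+) t2 ->
  x1 (+) x3 (+) (u1 (+) u2 (+) (v1 (+) v2)) = s1 (+) t1 (+) (s2 (+) t2).
Proof. by move: x1 x2 x3 u1 v1 u2 v2 s1 s2 t1 t2; do 11!case. Qed.

Section PolygonalDrawing.
Local Open Scope ring_scope.
Variable R : realType.
Implicit Types (a b p q r : R * R) (s t : seq (R * R)).

Fixpoint over_path a s p : bool :=
  if s is b :: s' then over a b p (+) over_path b s' p else false.

(** A polygonal path is given by its starting point and the list of its further
corners, so that concatenation of paths is concatenation of lists. *)
Definition sides a s := zip (a :: s) s.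

Definition apart a s q t : Prop :=
  forall e f, e \in sides a s -> f \in sides q t ->
    general_position e.1 e.2 f.1 f.2 /\ ~ segments_meet e.1 e.2 f.1 f.2.

Lemma apart_tl a b s q t : apart a (b :: s) q t -> apart b s q t.
Proof. by move=> h e f he hf; apply: h; rewrite // /sides /= inE he orbT. Qed.

Lemma apart_tr a s q r t : apart a s q (r :: t) -> apart a s r t.
Proof. by move=> h e f he hf; apply: h; rewrite // /sides /= inE hf orbT. Qed.

Lemma under_over a b p : under a b p = over a b p (+) straddles a b p.
Proof. by rewrite /under /over; case: (straddles a b p) => //=; case: ltP. Qed.

(** Summed over all pairs of sides, the terms of [segment_parity] at the inner
corners occur twice and cancel; only the four ends of the two paths remain.
The straddling terms, the difference between passing above and passing below
a point, telescope along a path. *)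
Lemma apart_parity a s q t : apart a s q t ->
  over_path a s q (+) over_path a s (last q t) (+)
  (over_path q t a (+) over_path q t (last a s)) =
  straddles q (last q t) a (+) straddles q (last q t) (last a s).
Proof.
elim: s a => [|b s IHs] a ap /=; first by rewrite !addbb.
apply: (xor_path_step _ (IHs b (apart_tl ap))).
have {}ap : apart a [:: b] q t.
  by move=> e f; rewrite inE => /eqP-> hf; apply: ap; rewrite // /sides /= inE eqxx.
elim: t q ap {IHs} => [|r t IHt] q ap /=.
  by rewrite addbb /straddles !addbb.
have [gp nm] : general_position a b q r /\ ~ segments_meet a b q r.
  by apply: (ap (a, b) (q, r)); rewrite /sides /= inE eqxx.
have := segment_parity gp nm; rewrite !under_over.
have tele p : straddles q (last r t) p = straddles q r p (+) straddles r (last r t) p.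
  by rewrite /straddles -!addbA addKb.
by rewrite !tele => h; apply: xor_side_step h (IHt r (apart_tr ap)).
Qed.

(** Only edges without a common end are kept apart; routes may cross themselves
and the two directions of an edge may have unrelated routes. These are
the edges that the parity argument compares, and the laxity elsewhere makes the
notion stable under sampling of arcs and under suppression of a vertex. *)
Definition poly_drawing (V : eqType) (L : seq V) (E : rel V) : Prop :=
  exists (pos : V -> R * R) (route : V -> V -> seq (R * R)),
  [/\ {in L &, forall x y, x != y -> (pos x).1 != (pos y).1},
      {in L &, forall x y, E x y -> last (pos x) (route x y) = pos y} &
      forall x y z w, x \in L -> y \in L -> z \in L -> w \in L ->
        E x y -> E z w -> uniq [:: x; y; z; w] ->
        apart (pos x) (route x y) (pos z) (route z w)].

Lemma poly_drawing_map (V W : eqType) (L : seq V) (E : rel V)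
    (K : seq W) (F : rel W) (h : W -> V) :
  {in K, forall x, h x \in L} -> {in K &, injective h} ->
  {in K &, forall x y, F x y -> E (h x) (h y)} ->
  poly_drawing L E -> poly_drawing K F.
Proof.
move=> hL hI hE [pos [route [posD routeL ap]]].
exists (pos \o h), (fun x y => route (h x) (h y)); split.
- move=> x y xK yK xy; apply: posD; rewrite ?hL //.
  by apply: contra xy => /eqP/hI->.
- by move=> x y xK yK xy /=; apply: routeL; rewrite ?hL // hE.
- move=> x y z w xK yK zK wK xy zw u; apply: ap; rewrite ?hL ?hE //.
  rewrite -[_ :: _]/(map h [:: x; y; z; w]) map_inj_in_uniq //.
  by move=> i j; rewrite !inE => hi hj; apply: hI; [move: hi|move: hj];
    case/or4P => /eqP->.
Qed.

Definition link (A : rel nat) (y z : nat) : rel nat :=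
  fun i j => A i j || ((i == y) && (j == z) || (i == z) && (j == y)).

(** The new edge follows the old path through [x]. Both halves of that path stay
apart from every edge that misses [y], [z] and the suppressed vertex [x]. *)
Lemma poly_drawing_suppress (L : seq nat) (A : rel nat) (x y z : nat) :
  x \in L -> y \in L -> z \in L -> uniq L -> x != y -> x != z ->
  A y x -> A x y -> A x z -> A z x ->
  poly_drawing L A -> poly_drawing (rem x L) (link A y z).
Proof.
move=> xL yL zL uL nxy nxz yx xy xz zx [pos [route [posD routeL ap]]].
have sub i : i \in rem x L -> i \in L by exact: mem_rem.
have nx i : i \in rem x L -> x != i.
  by rewrite mem_rem_uniq // inE eq_sym => /andP[].
pose route' i j := if A i j then route i j else route i x ++ route x j.
exists pos, route'.
have both i j : link A y z i j -> ~~ A i j -> [/\ A i x, A x j, i != x & j != x].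
  by rewrite /link => /orP[->//|/orP[]/andP[/eqP-> /eqP->] _]; split=> //;
    rewrite eq_sym.
split.
- by move=> i j /sub iL /sub jL; apply: posD.
- move=> i j /sub iL /sub jL ij; rewrite /route'.
  case: ifPn => [Aij|nA]; first exact: routeL.
  have [ix xj _ _] := both _ _ ij nA.
  by rewrite last_cat !routeL.
have sides_cat a s t : sides a (s ++ t) = sides a s ++ sides (last a s) t.
  by rewrite /sides; elim: s a => [|b s IHs] a //=; rewrite -IHs.
have half i j f : i \in L -> j \in L -> link A y z i j ->
    f \in sides (pos i) (route' i j) ->
    exists u v, [/\ u \in L, v \in L, A u v, f \in sides (pos u) (route u v) &
      (u, v) = (i, j) \/
      ~~ A i j /\ ((u, v) = (i, x) \/ (u, v) = (x, j))].
  move=> iL jL ij; rewrite /route'; case: ifPn => [Aij hf|nA].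
    by exists i, j; split=> //; left.
  have [ix xj _ _] := both _ _ ij nA.
  rewrite sides_cat routeL // mem_cat => /orP[hf|hf].
    by exists i, x; split=> //; right; split=> //; left.
  by exists x, j; split=> //; right; split=> //; right.
move=> i j k l iK jK kK lK ij kl u e f he hf.
have [u1 [v1 [u1L v1L A1 he' uv1]]] := half _ _ _ (sub _ iK) (sub _ jK) ij he.
have [u2 [v2 [u2L v2L A2 hf' uv2]]] := half _ _ _ (sub _ kK) (sub _ lK) kl hf.
apply: (ap u1 v1 u2 v2) he' hf' => //.
have := (nx _ iK, nx _ jK, nx _ kK, nx _ lK).
move: u; rewrite /= !inE !negb_or => /and4P[/and3P[n1 n2 n3] /andP[n4 n5] n6 _].
move=> [[[m1 m2] m3] m4].
(* Two new edges would both join y and z, and so share ends. *)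
have absurd : ~~ A i j -> ~~ A k l -> False.
  move=> hij hkl; move: ij kl; rewrite /link (negPf hij) (negPf hkl) /=.
  by move=> /orP[]/andP[/eqP ei /eqP ej] /orP[]/andP[/eqP ek /eqP el];
    move: n2 n3 n4 n5; rewrite ei ej ek el eqxx ?andbF.
case: uv1 => [[-> ->]|[hij [[-> ->]|[-> ->]]]];
  case: uv2 => [[-> ->]|[hkl [[-> ->]|[-> ->]]]]; try (by case: absurd);
  by rewrite ?n1 ?n2 ?n3 ?n4 ?n5 ?n6 ?m1 ?m2 ?m3 ?m4 // ?(eq_sym _ x)
     ?n1 ?n2 ?n3 ?n4 ?n5 ?n6 ?m1 ?m2 ?m3 ?m4.
Qed.

(** A symbol stands for a truth value in a drawing: [ [:: u; v; w] ] says that the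
route from [u] to [v] passes above [w] an odd number of times, [ [:: u; w] ] says
that [u] lies to the left of [w], and the empty list is the constant true. The equation
of [apart_parity] for a pair of independent edges says that the sum of
[pair_symbols] vanishes; comparisons are oriented so that the smaller label
comes first, at the cost of a constant. *)
Definition symbol := seq nat.

Definition less_symbols (u w : nat) : seq symbol :=
  if (u < w)%N then [:: [:: u; w]] else [:: [::]; [:: w; u]].

Definition pair_symbols (c : (nat * nat) * (nat * nat)) : seq symbol :=
  let: ((u, v), (w, z)) := c in
  [:: [:: u; v; w]; [:: u; v; z]; [:: w; z; u]; [:: w; z; v]]
  ++ less_symbols w u ++ less_symbols z u ++ less_symbols w v ++ less_symbols z v.

(** In the sum of all equations every symbol cancels, except for the constant,
which survives: the equations are inconsistent. *)
Definition odd_system (cs : seq ((nat * nat) * (nat * nat))) : bool :=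
  let l := flatten (map pair_symbols cs) in
  odd (count_mem [::] l) &&
  all (fun x => (x == [::]) || ~~ odd (count_mem x l)) l.

Lemma sum_symbols_odd (F : symbol -> bool) (l : seq symbol) :
  F [::] -> odd (count_mem [::] l) ->
  all (fun x => (x == [::]) || ~~ odd (count_mem x l)) l ->
  \big[addb/false]_(x <- l) F x.
Proof.
move=> F0 odd0 /allP even.
have iterE n c : iterop n addb c false = odd n && c.
  elim: n => [|[|n] IHn] //.
  by rewrite iteropS iterS -(iteropS false) IHn /=; move: c {IHn}; case: (odd n) => -[].
rewrite -big_undup_iterop_count (bigD1_seq [::]) ?undup_uniq //=; last first.
  by rewrite mem_undup -has_pred1 has_count; case: (count_mem _ _) odd0.
rewrite iterE odd0 F0 big_seq_cond big1 // => x.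
by rewrite mem_undup iterE => /andP[/even/orP[->//|/negPf->]].
Qed.

Definition independent_edges (L : seq nat) (A : rel nat)
    (c : (nat * nat) * (nat * nat)) : bool :=
  let: ((u, v), (w, z)) := c in
  [&& all (mem L) [:: u; v; w; z], A u v, A w z & uniq [:: u; v; w; z]].

Lemma odd_system_not_drawn L A cs :
  all (independent_edges L A) cs -> odd_system cs -> ~ poly_drawing L A.
Proof.
move=> /allP hcs /andP[odd0 even] [pos [route [posD routeL ap]]].
pose F (x : symbol) := match x with
  | [::] => true
  | [:: u; w] => (pos u).1 < (pos w).1
  | [:: u; v; w] => over_path (pos u) (route u v) (pos w)
  | _ => false end.
have := @sum_symbols_odd F _ erefl odd0 even; rewrite big_flatten big_map.
rewrite big_seq big1 // => -[[u v] [w z]] /hcs /and4P[/= /and5P[uL vL wL zL _]].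
move=> uv wz u4.
have {ap} := apart_parity (ap _ _ _ _ uL vL wL zL uv wz u4).
rewrite !routeL // !big_cons !big_cat /=.
have lessE i j : i \in L -> j \in L -> i != j ->
    \big[addb/false]_(x <- less_symbols i j) F x = ((pos i).1 < (pos j).1).
  move=> iL jL ij; rewrite /less_symbols; case: ifP => _; rewrite !big_cons big_nil /=.
    by rewrite addbF.
  rewrite addbF; have := posD _ _ iL jL ij.
  by case: ltgtP.
move: u4; rewrite /= !inE !negb_or => /and4P[/and3P[n1 n2 n3] /andP[n4 n5] n6 _].
rewrite !lessE // 1?eq_sym // /straddles => e; move: e.
move: (over_path _ _ _) (over_path _ _ _) (over_path _ _ _) (over_path _ _ _).
move: (_ < _) (_ < _) (_ < _) (_ < _).
by do 8!case.
Qed.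

Definition ordered_disjoint_pairs (E : seq (nat * nat)) :=
  [seq c <- [seq (e, f) | e <- E, f <- E] |
    (index c.1 E < index c.2 E)%N && uniq [:: c.1.1; c.1.2; c.2.1; c.2.2]].

Definition K5_edges := [seq e <- [seq (i, j) | i <- iota 0 5, j <- iota 0 5] | (e.1 < e.2)%N].
Definition K33_edges := [seq (i, j) | i <- iota 0 3, j <- iota 3 3].

(** Each symbol [ [:: u; v; w] ] occurs in the pairs formed by the edge [uv] and an
edge at [w] that avoids [u] and [v]; there are two of these in the complete
graph on five vertices, and likewise in the complete bipartite graph below. *)
Lemma K5_not_drawn : ~ poly_drawing (iota 0 5) (fun i j => i != j).
Proof.
by apply: (@odd_system_not_drawn _ _ (ordered_disjoint_pairs K5_edges)); vm_compute.
Qed.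

Lemma K33_not_drawn : ~ poly_drawing (iota 0 6) (fun i j => (i < 3 <= j)%N).
Proof.
by apply: (@odd_system_not_drawn _ _ (ordered_disjoint_pairs K33_edges)); vm_compute.
Qed.

End PolygonalDrawing.

(** * A test for nonplanarity *)

(** [has] and [all] evaluate both arguments of their connectives when they are
computed by the virtual machine; these versions stop at the first answer. *)
Fixpoint has_lazy (T : Type) (p : T -> bool) (s : seq T) : bool :=
  if s is x :: s' then (if p x then true else has_lazy p s') else false.

Fixpoint all_lazy (T : Type) (p : T -> bool) (s : seq T) : bool :=
  if s is x :: s' then (if p x then all_lazy p s' else false) else true.

Lemma has_lazyE T (p : T -> bool) s : has_lazy p s = has p s.
Proof. by elim: s => //= x s ->; case: (p x). Qed.

Lemma all_lazyE T (p : T -> bool) s : all_lazy p s = all p s.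
Proof. by elim: s => //= x s ->; case: (p x). Qed.

Fixpoint splits (L : seq nat) : seq (seq nat * seq nat) :=
  if L is x :: L' then
    let ss := splits L' in
    map (fun c => (x :: c.1, c.2)) ss ++ map (fun c => (c.1, x :: c.2)) ss
  else [:: ([::], [::])].

Lemma splits_perm L c : c \in splits L -> perm_eq (c.1 ++ c.2) L.
Proof.
elim: L c => [|x L IHL] c /=; first by rewrite inE => /eqP->.
rewrite mem_cat => /orP[]/mapP[d /IHL hd ->] /=; first by rewrite perm_cons.
by rewrite -cat1s perm_catCA /= perm_cons.
Qed.

Lemma filter_splits (p : pred nat) L : ([seq x <- L | p x], [seq x <- L | ~~ p x]) \in splits L.
Proof.
elim: L => [|x L IHL] //=; rewrite mem_cat.
by case: (p x); apply/orP; [left|right]; apply/mapP;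
  exists ([seq x <- L | p x], [seq x <- L | ~~ p x]).
Qed.

Definition is_K5 (A : rel nat) (L : seq nat) : bool :=
  all_lazy (fun i => all_lazy (fun j => if i == j then true else A i j) L) L.

Definition is_K33 (A : rel nat) (S Q : seq nat) : bool :=
  all_lazy (fun i => all_lazy (A i) Q) S.

(** A subdivision of the complete graph on five vertices, or of the complete
bipartite graph on three and three, becomes the graph itself after deleting the
superfluous vertices and suppressing the subdividing ones. *)
Definition suppress_or_delete (test : rel nat -> seq nat -> bool)
    (A : rel nat) (L : seq nat) : bool :=
  has_lazy (fun x => let L' := rem x L in
    if test A L' then true else
    has_lazy (fun y => if A x y then if A y x then
      has_lazy (fun z =>
        if A y z then false else
        if A x z then if A z x then if x != z then
        if x != y then test (link A y z) L' else false
        else false else false else false) L'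
      else false else false) L') L.

Definition nonplanar6 (A : rel nat) (L : seq nat) : bool :=
  if has_lazy (fun c => if size c.1 == 3%N then is_K33 A c.1 c.2 else false) (splits L)
  then true else suppress_or_delete is_K5 A L.

Definition nonplanar_test (k : nat) : rel nat -> seq nat -> bool :=
  match k with
  | 5 => is_K5
  | 6 => nonplanar6
  | _ => suppress_or_delete nonplanar6
  end.

Section NonplanarityTest.
Variable R : realType.

Lemma is_K5_sound A L : uniq L -> size L = 5%N -> is_K5 A L -> ~ poly_drawing R L A.
Proof.
move=> uL sL; rewrite /is_K5 all_lazyE => /allP hA dr.
apply: (@K5_not_drawn R); apply: (poly_drawing_map (h := nth 0%N L)) dr.
- by move=> i; rewrite mem_iota => /andP[_ hi]; rewrite mem_nth // sL.
- by move=> i j; rewrite !mem_iota -sL => /andP[_ hi] /andP[_ hj] /eqP;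
    rewrite nth_uniq // => /eqP.
- move=> i j; rewrite !mem_iota -sL => /andP[_ hi] /andP[_ hj] ij.
  have := hA _ (mem_nth 0%N hi); rewrite all_lazyE => /allP/(_ _ (mem_nth 0%N hj)).
  by rewrite nth_uniq // (negPf ij).
Qed.

Lemma is_K33_sound A S Q : uniq (S ++ Q) -> size S = 3%N -> size Q = 3%N ->
  is_K33 A S Q -> ~ poly_drawing R (S ++ Q) A.
Proof.
move=> uL sS sQ; rewrite /is_K33 all_lazyE => /allP hA dr.
have sL : size (S ++ Q) = 6%N by rewrite size_cat sS sQ.
apply: (@K33_not_drawn R); apply: (poly_drawing_map (h := nth 0%N (S ++ Q))) dr.
- by move=> i; rewrite mem_iota => /andP[_ hi]; rewrite mem_nth // sL.
- by move=> i j; rewrite !mem_iota -sL => /andP[_ hi] /andP[_ hj] /eqP;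
    rewrite nth_uniq // => /eqP.
- move=> i j _ /[!mem_iota]/andP[_ j6] /andP[i3 j3]; rewrite !nth_cat sS i3 ltnNge j3 /=.
  have hi : (i < size S)%N by rewrite sS.
  have := hA _ (mem_nth 0%N hi); rewrite all_lazyE => /allP; apply; apply: mem_nth.
  by rewrite sQ ltn_subLR.
Qed.

Lemma poly_drawing_mem (V : eqType) (L K : seq V) (E : rel V) :
  {subset K <= L} -> poly_drawing R L E -> poly_drawing R K E.
Proof. by move=> KL; apply: (poly_drawing_map (h := id)) => // x /KL. Qed.

Lemma suppress_or_delete_sound (test : rel nat -> seq nat -> bool) k :
  (forall A L, uniq L -> size L = k -> test A L -> ~ poly_drawing R L A) ->
  forall A L, uniq L -> size L = k.+1 -> suppress_or_delete test A L ->
    ~ poly_drawing R L A.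
Proof.
move=> sound A L uL sL; rewrite /suppress_or_delete has_lazyE => /hasP[x xL].
have uL' : uniq (rem x L) by rewrite rem_uniq.
have sL' : size (rem x L) = k by rewrite size_rem // sL.
case: ifP => [tL _|_].
  by move=> dr; apply: (sound _ _ uL' sL' tL); apply: poly_drawing_mem dr => y /mem_rem.
rewrite has_lazyE => /hasP[y yL]; do 2!case: ifP => // ?.
rewrite has_lazyE => /hasP[z zL]; do 5!case: ifP => // ?.
move=> tL dr; apply: (sound _ _ uL' sL' tL).
by apply: poly_drawing_suppress dr; rewrite ?(mem_rem yL) ?(mem_rem zL).
Qed.

Lemma nonplanar6_sound A L : uniq L -> size L = 6%N -> nonplanar6 A L ->
  ~ poly_drawing R L A.
Proof.
move=> uL sL; rewrite /nonplanar6 has_lazyE; case: ifP => [/hasP[[S Q] hc]|_].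
  have := splits_perm hc => /= pL; case: eqP => //= sS K _ dr.
  have sQ : size Q = 3%N.
    by move: (perm_size pL); rewrite size_cat sL sS => /(congr1 (subn^~ 3)) /=;
      rewrite addKn.
  have uSQ : uniq (S ++ Q) by rewrite (perm_uniq pL).
  have := is_K33_sound uSQ sS sQ K; apply.
  by apply: poly_drawing_mem dr => x; rewrite (perm_mem pL).
by apply: suppress_or_delete_sound (uL) (sL); exact: is_K5_sound.
Qed.

Lemma nonplanar_test_sound k A L : (5 <= k <= 7)%N -> uniq L -> size L = k ->
  nonplanar_test k A L -> ~ poly_drawing R L A.
Proof.
case: k => [|[|[|[|[|[|[|[|k]]]]]]]] //= _; first exact: is_K5_sound.
  exact: nonplanar6_sound.
exact: suppress_or_delete_sound nonplanar6_sound _ _.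
Qed.

End NonplanarityTest.

(** * From arcs to polygons *)

Section Sampling.
Local Open Scope classical_set_scope.
Local Open Scope ring_scope.
Variable R : realType.
Implicit Types g h : R -> R * R.

Lemma arc_modulus g (s eps : R) :
  {within `[0, 1], continuous g} -> 0 <= s <= 1 -> 0 < eps ->
  exists2 d, 0 < d & forall s', 0 <= s' <= 1 -> `|s' - s| < d ->
    `|(g s').1 - (g s).1| < eps /\ `|(g s').2 - (g s).2| < eps.
Proof.
move=> /subspace_continuousP cg s01 eps0.
have /cvgrPdist_lt/(_ _ eps0) : g @ within `[0, 1] (nbhs s) --> g s.
  by apply: cg; rewrite /= in_itv.
move=> /nbhs_ballP[d /= d0 hd]; exists d => // s' s'01 s's.
have := hd s'; rewrite /ball /= distrC => /(_ s's); rewrite /= in_itv /= => /(_ s'01).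
by rewrite prod_normE /= gt_max !(distrC (g s).1) !(distrC (g s).2) => /andP.
Qed.

Lemma convex_near (u v c l eps : R) : 0 <= l <= 1 ->
  `|u - c| < eps -> `|v - c| < eps -> `|(1 - l) * u + l * v - c| < eps.
Proof.
move=> /andP[l0 l1] hu hv; pose M := Num.max `|u - c| `|v - c|.
apply: (@le_lt_trans _ _ M); last by rewrite gt_max hu.
have : `|u - c| <= M by rewrite le_max lexx.
have : `|v - c| <= M by rewrite le_max lexx orbT.
rewrite !ler_norml => /andP[v1 v2] /andP[u1 u2]; have l1' : 0 <= 1 - l by lra.
have h1 : 0 <= l * (v - c + M) by rewrite mulr_ge0 //; lra.
have h2 : 0 <= (1 - l) * (u - c + M) by rewrite mulr_ge0 //; lra.
have h3 : 0 <= l * (M - (v - c)) by rewrite mulr_ge0 //; lra.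
have h4 : 0 <= (1 - l) * (M - (u - c)) by rewrite mulr_ge0 //; lra.
by apply/andP; split; lra.
Qed.

(** Near any pair of parameters the two arcs stay in disjoint convex boxes, which
also contain the short chords. Compactness of the square of parameters makes
one fineness suffice. *)
Lemma fine_chords_disjoint g h :
  {within `[0, 1], continuous g} -> {within `[0, 1], continuous h} ->
  (forall s t, 0 <= s <= 1 -> 0 <= t <= 1 -> g s <> h t) ->
  \forall m \near \oo, forall s s' t t',
    0 <= s <= 1 -> 0 <= s' <= 1 -> 0 <= t <= 1 -> 0 <= t' <= 1 ->
    `|s' - s| <= m.+1%:R^-1 -> `|t' - t| <= m.+1%:R^-1 ->
    ~ segments_meet (g s) (g s') (h t) (h t').
Proof.
move=> cg ch gh.
have cpt : compact (`[0, 1] `*` `[0, 1] : set (R * R)).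
  by apply: compact_setX; exact: segment_compact.
have /compact_near_coveringP/near_covering_withinP nc := cpt.
pose P (m : nat) (c : R * R) := forall s' t',
  0 <= s' <= 1 -> 0 <= t' <= 1 ->
  `|s' - c.1| <= m.+1%:R^-1 -> `|t' - c.2| <= m.+1%:R^-1 ->
  ~ segments_meet (g c.1) (g s') (h c.2) (h t').
suff H : \forall m \near \oo, `[0, 1] `*` `[0, 1] `<=` P m.
  near=> m => s s' t t' s01 s'01 t01 t'01 ss' tt'.
  have Pm : `[0, 1] `*` `[0, 1] `<=` P m by near: m.
  by apply: (Pm (s, t)) => //; split; rewrite /= in_itv.
apply: nc => -[s t] [/=]; rewrite !in_itv /= => s01 t01.
have [eps eps0 sep] : exists2 eps, 0 < eps & forall p q : R * R,
    `|p.1 - (g s).1| < eps -> `|p.2 - (g s).2| < eps ->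
    `|q.1 - (h t).1| < eps -> `|q.2 - (h t).2| < eps -> p.1 = q.1 -> p.2 = q.2 -> False.
  have [e1|n1] := eqVneq (g s).1 (h t).1; last first.
    exists (`|(g s).1 - (h t).1| / 2).
      by rewrite divr_gt0 // normr_gt0 subr_eq0.
    move=> p q a1 _ b1 _ e _; move: b1; rewrite -e => b1.
    have := ler_distD p.1 (g s).1 (h t).1; rewrite (distrC (g s).1 p.1); lra.
  have [e2|n2] := eqVneq (g s).2 (h t).2; last first.
    exists (`|(g s).2 - (h t).2| / 2).
      by rewrite divr_gt0 // normr_gt0 subr_eq0.
    move=> p q _ a1 _ b1 _ e; move: b1; rewrite -e => b1.
    have := ler_distD p.2 (g s).2 (h t).2; rewrite (distrC (g s).2 p.2); lra.
  by case: (gh s t s01 t01); apply/eqP; rewrite -pair_eqE /= e1 e2 !eqxx.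
have [dg dg0 hg] := arc_modulus cg s01 eps0.
have [dh dh0 hh] := arc_modulus ch t01 eps0.
have dg2 : 0 < dg / 2 by rewrite divr_gt0.
have dh2 : 0 < dh / 2 by rewrite divr_gt0.
near=> c m => c01 s' t' s'01 t'01 s's t't [l [k [l01 k01 e1 e2]]].
case: (c01) => /= c1 c2.
move: c1 c2; rewrite !in_itv /= => c1 c2.
have [bs1 bs2] : `|c.1 - s| < dg / 2 /\ `|c.2 - t| < dh / 2.
  near: c; apply/nbhs_ballP; exists (Num.min (dg / 2) (dh / 2)).
    by rewrite /= lt_min !divr_gt0.
  by move=> [c1' c2'] [/=]; rewrite /ball /= !lt_min !(distrC _ c1') !(distrC _ c2')
    => /andP[? _] /andP[_ ?].
have [bm1 bm2] : m.+1%:R^-1 < dg / 2 /\ m.+1%:R^-1 < dh / 2.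
  by split; near: m; [exact: (near_infty_natSinv_lt (PosNum dg2)) |
    exact: (near_infty_natSinv_lt (PosNum dh2))].
have gs' : `|s' - s| < dg.
  by rewrite (le_lt_trans (ler_distD c.1 _ _)) // [dg]splitr ltrD // (le_lt_trans s's).
have ht' : `|t' - t| < dh.
  by rewrite (le_lt_trans (ler_distD c.2 _ _)) // [dh]splitr ltrD // (le_lt_trans t't).
have [|g1 g2] := hg c.1 c1; first by rewrite (lt_trans bs1) // ltr_pdivrMr // ltr_pMr // ltr1n.
have [|h1 h2] := hh c.2 c2; first by rewrite (lt_trans bs2) // ltr_pdivrMr // ltr_pMr // ltr1n.
have [g3 g4] := hg s' s'01 gs'; have [h3 h4] := hh t' t'01 ht'.
apply: (sep (((1 - l) * (g c.1).1 + l * (g s').1), ((1 - l) * (g c.1).2 + l * (g s').2))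
   (((1 - k) * (h c.2).1 + k * (h t').1), ((1 - k) * (h c.2).2 + k * (h t').2))) => //=;
  exact: convex_near.
Unshelve. all: end_near.
Qed.

(** Each pair of distinct points rules out at most one shear. *)
Lemma shear_exists (pts : seq (R * R)) : exists t : R,
  {in pts &, forall p q, p != q -> p.1 + t * p.2 != q.1 + t * q.2}.
Proof.
pose bad (c : (R * R) * (R * R)) := (c.2.1 - c.1.1) / (c.1.2 - c.2.2).
pose bads := [seq bad (p, q) | p <- pts, q <- pts].
exists (1 + \sum_(b <- bads) `|b|) => p q pP qP npq; apply/eqP => e.
have [e2|n2] := eqVneq p.2 q.2.
  move: e; rewrite e2 => /addIr e1; case/eqP: npq.
  by apply/eqP; rewrite -pair_eqE /= e1 e2 !eqxx.
have inb : bad (p, q) \in bads by apply/allpairsP; exists (p, q).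
have : bad (p, q) = 1 + \sum_(b <- bads) `|b|.
  have d0 : p.2 - q.2 != 0 by rewrite subr_eq0.
  rewrite /bad /=; apply: (mulIf d0); rewrite divfK //.
  move: (1 + _) e => t e; have -> : q.1 = p.1 + t * p.2 - t * q.2.
    by rewrite e addrK.
  by ring.
apply/eqP; rewrite lt_eqF // (le_lt_trans (ler_norm _)) //.
by rewrite (big_rem _ inb) /= addrCA ltrDl ltr_pwDl // sumr_ge0.
Qed.

Lemma samples_sides (f : nat -> R * R) k N e :
  e \in sides (f k) [seq f i | i <- iota k.+1 N] ->
  exists2 i, (k <= i < k + N)%N & e = (f i, f i.+1).
Proof.
elim: N k => [|N IHN] k //=; rewrite /sides /= inE => /orP[/eqP->|/IHN[i ik ->]].
  by exists k => //; rewrite leqnn -{1}[k]addn0 ltn_add2l.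
by exists i => //; move: ik; rewrite addnS addSn => /andP[/ltnW-> ->].
Qed.

Lemma last_samples (f : nat -> R * R) x m :
  last x [seq f i | i <- iota 1 m.+1] = f m.+1.
Proof. by rewrite -(addn1 m) iotaD map_cat last_cat addn1. Qed.

(** Arcs of edges without a common end are disjoint, so their sampled polygons
are disjoint once the samples are fine enough; a shear then makes the abscissas
of all samples distinct. *)
Lemma planar_poly_drawing (G : sgraph) :
  planar R G -> poly_drawing R (enum G) (@adj G).
Proof.
move=> [pos [edge [posI arcs thru cross]]].
have /choice[g hg] : forall c : G * G, exists g : R -> R * R, adj c.1 c.2 ->
    [/\ {within `[0, 1], continuous g}, {in `[0, 1] &, injective g},
     g @` `[0, 1] = edge c.1 c.2, g 0 = pos c.1 & g 1 = pos c.2].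
  move=> c; case: (boolP (adj c.1 c.2)) => [/arcs[_ [g ?]]|nc]; first by exists g.
  by exists (fun=> 0).
have inI (s : R) : 0 <= s <= 1 -> s \in `[0, 1]%R by rewrite in_itv.
have far x y z w s t : adj x y -> adj z w -> uniq [:: x; y; z; w] ->
    0 <= s <= 1 -> 0 <= t <= 1 -> g (x, y) s <> g (z, w) t.
  move=> xy zw; rewrite /= !inE !negb_or => /and4P[/and3P[n1 n2 n3] /andP[n4 n5] n6 _].
  move=> s01 t01 e; have [_ _ ime _ _] := hg (x, y) xy; have [_ _ imf _ _] := hg (z, w) zw.
  have pe : edge x y (g (x, y) s) by rewrite -ime; exists s => //; exact: inI.
  have pf : edge z w (g (x, y) s) by rewrite -imf e; exists t => //; exact: inI.
  have [||u _ pu] := cross x y z w xy zw _ _ _ (conj pe pf).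
  - by rewrite xpair_eqE (negPf n2).
  - by rewrite xpair_eqE (negPf n3).
  rewrite -pu in pe pf; move: n2 n3 n4 n5.
  by case: (thru _ _ _ xy pe) (thru _ _ _ zw pf) => -> [] ->; rewrite eqxx.
pose fine_at (c : (G * G) * (G * G)) (m : nat) :=
    adj c.1.1 c.1.2 -> adj c.2.1 c.2.2 -> uniq [:: c.1.1; c.1.2; c.2.1; c.2.2] ->
    forall s s' t t',
    0 <= s <= 1 -> 0 <= s' <= 1 -> 0 <= t <= 1 -> 0 <= t' <= 1 ->
    `|s' - s| <= m.+1%:R^-1 -> `|t' - t| <= m.+1%:R^-1 ->
    ~ segments_meet (g c.1 s) (g c.1 s') (g c.2 t) (g c.2 t').
have [m fine] : exists m : nat, forall c, fine_at c m.
  suff : \forall m \near \oo, forall c, fine_at c m by exact: filter_ex.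
  apply: (@filter_forall nat ((G * G) * (G * G))%type fine_at) => -[[x y] [z w]].
  apply: filter_imply => xy; apply: filter_imply => zw; apply: filter_imply => u4.
  apply: fine_chords_disjoint.
  - by have [] := hg (x, y) xy.
  - by have [] := hg (z, w) zw.
  - by move=> s t; exact: far.
pose par i : R := i%:R / m.+1%:R.
have par01 i : (i <= m.+1)%N -> 0 <= par i <= 1.
  by move=> im; rewrite divr_ge0 //= ler_pdivrMr ?ltr0n // mul1r ler_nat.
have parS i : `|par i.+1 - par i| <= m.+1%:R^-1.
  by rewrite /par -mulrBl -[i.+1]addn1 natrD addrAC subrr add0r mul1r ger0_norm.
pose pts := [seq g c (par i) | c <- enum {: G * G}, i <- iota 0 m.+2] ++ map pos (enum G).
have [t ht] := shear_exists pts.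
pose S (p : R * R) := (p.1 + t * p.2, p.2).
have inpts c i : (i <= m.+1)%N -> g c (par i) \in pts.
  move=> im; rewrite mem_cat; apply/orP; left; apply/allpairsP; exists (c, i).
  by rewrite mem_enum mem_iota.
have Sdist c i d j : (i <= m.+1)%N -> (j <= m.+1)%N -> g c (par i) <> g d (par j) ->
    (S (g c (par i))).1 != (S (g d (par j))).1.
  by move=> im jm /eqP n; apply: ht; rewrite ?inpts.
have par0 : par 0 = 0 by rewrite /par mul0r.
have par1 : par m.+1 = 1 by rewrite /par divff // pnatr_eq0.
exists (S \o pos), (fun x y => [seq S (g (x, y) (par i)) | i <- iota 1 m.+1]); split.
- move=> x y _ _ xy; apply: ht; rewrite ?mem_cat ?map_f ?orbT ?mem_enum //.
  by apply: contra xy => /eqP/posI->.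
- move=> x y _ _ xy; have [_ _ _ _ /= g1] := hg (x, y) xy.
  transitivity (S (g (x, y) (par m.+1))); last by rewrite par1 g1.
  exact: (last_samples (fun i => S (g (x, y) (par i)))).
- move=> x y z w _ _ _ _ xy zw u4 e f.
  have [_ gI _ g0 _] := hg (x, y) xy; have [_ hI _ h0 _] := hg (z, w) zw.
  have -> : (S \o pos) x = S (g (x, y) (par 0)) by rewrite par0 g0.
  have -> : (S \o pos) z = S (g (z, w) (par 0)) by rewrite par0 h0.
  move=> /(samples_sides (f := fun i => S (g (x, y) (par i))))[i /andP[_ im] ->].
  move=> /(samples_sides (f := fun i => S (g (z, w) (par i))))[j /andP[_ jm] ->].
  have im1 := ltnW im; have jm1 := ltnW jm.
  split.
    have step k : par k <> par k.+1.
      move=> /(congr1 (fun s => s * m.+1%:R)); rewrite !divfK ?pnatr_eq0 //.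
      by move/eqP; rewrite eqr_nat -[X in X == _]addn0 -addn1 eqn_add2l.
    rewrite /general_position /= !inE !negb_or.
    rewrite !Sdist //=; try (apply: far => //; exact: par01).
      by move/hI => /(_ (inI _ (par01 _ jm1)) (inI _ (par01 _ jm))); exact: step.
    by move/gI => /(_ (inI _ (par01 _ im1)) (inI _ (par01 _ im))); exact: step.
  move=> [l [k [l01 k01 /= e1 e2]]].
  apply: (fine ((x, y), (z, w)) xy zw u4 (par i) (par i.+1) (par j) (par j.+1));
    rewrite ?par01 //.
  exists l, k; split => //; move: e1 e2.
  move: (g (x, y) (par i)) (g (x, y) (par i.+1)) => a b.
  move: (g (z, w) (par j)) (g (z, w) (par j.+1)) => q r e1 e2.
  transitivity ((1 - l) * (a.1 + t * a.2) + l * (b.1 + t * b.2)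
    - t * ((1 - l) * a.2 + l * b.2)); first by ring.
  by rewrite e1 e2; ring.
Qed.

End Sampling.

(** * Straight-line drawings *)

Section StraightLine.
Variable R : realType.
Local Open Scope classical_set_scope.
Local Open Scope ring_scope.

(** Twice the signed area of the triangle [pqr]. *)
Definition det (T : pzRingType) (p q r : T * T) : T :=
  (q.1 - p.1) * (r.2 - p.2) - (q.2 - p.2) * (r.1 - p.1).

Definition segment (p q : R * R) : set (R * R) :=
  [set ((1 - l) * p.1 + l * q.1, (1 - l) * p.2 + l * q.2) | l in `[0, 1]].

Lemma segment_sym p q : segment p q = segment q p.
Proof.
have sub u v : segment u v `<=` segment v u.
  move=> w [l /=]; rewrite in_itv /= => /andP[l0 l1] <-; exists (1 - l).
    by rewrite /= in_itv /=; apply/andP; split; lra.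
  by congr pair; ring.
by rewrite eqEsubset.
Qed.

Lemma segment_is_arc p q : p != q -> is_arc p q (segment p q).
Proof.
move=> npq; exists (fun l => ((1 - l) * p.1 + l * q.1, (1 - l) * p.2 + l * q.2)).
split=> //; last 2 first.
- by rewrite subr0 !mul1r !mul0r !addr0; case: p npq.
- by rewrite subrr !mul1r !mul0r !add0r; case: q npq.
- apply: continuous_subspaceT => l.
  have affine (a b : R) : ((1 - m) * a + m * b) @[m --> l] --> (1 - l) * a + l * b.
    apply: cvgD; apply: cvgMr_tmp; last exact: cvg_id.
    by apply: cvgB; [exact: cvg_cst | exact: cvg_id].
  exact: (@cvg_pair _ _ _ (nbhs l) _ _ _ _ _ _ _ (affine _ _) (affine _ _)).
- move=> l m _ _ [e1 e2]; apply/eqP; rewrite -subr_eq0; apply/negPn/negP => lm.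
  case/eqP: npq; apply/eqP; rewrite -pair_eqE /= -!(subr_eq0 p.1) -!(subr_eq0 p.2).
  apply/andP; split; apply/eqP; apply: (mulfI lm); rewrite mulr0.
    have -> : (l - m) * (p.1 - q.1) =
      ((1 - m) * p.1 + m * q.1) - ((1 - l) * p.1 + l * q.1) by ring.
    by rewrite e1 subrr.
  have -> : (l - m) * (p.2 - q.2) =
    ((1 - m) * p.2 + m * q.2) - ((1 - l) * p.2 + l * q.2) by ring.
  by rewrite e2 subrr.
Qed.

Lemma det_segment p q r : segment p q r -> det p q r = 0.
Proof. by move=> [l _ <-]; rewrite /det /=; ring. Qed.

Lemma segments_common_end p q r u : det p q r != 0 ->
  segment p q u -> segment p r u -> u = p.
Proof.
move=> d0 [l _ <-] [m _ [e1 e2]].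
have m0 : m = 0.
  apply: (mulIf d0); rewrite mul0r.
  have -> : m * det p q r = (q.1 - p.1) * (((1 - m) * p.2 + m * r.2) - p.2)
    - (q.2 - p.2) * (((1 - m) * p.1 + m * r.1) - p.1) by rewrite /det; ring.
  by rewrite e1 e2; ring.
by rewrite -e1 -e2 m0 subr0 !mul1r !mul0r !addr0; case: (p).
Qed.

(** Along the second segment [det p q] interpolates two values of the same sign,
so it does not vanish there. *)
Lemma segments_separated p q r s u :
  0 < det p q r * det p q s -> segment p q u -> ~ segment r s u.
Proof.
move=> pos /det_segment hu [l /=]; rewrite in_itv /= => /andP[l0 l1] e.
have : (1 - l) * det p q r + l * det p q s = 0.
  by rewrite -hu -e /det /=; ring.
have l1' : 0 <= 1 - l by lra.
move: pos; move: (det p q r) (det p q s) => a b ab h.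
have : 0 < (1 - l) * (a * a) + l * (a * b).
  have aa : 0 < a * a by rewrite -expr2 exprn_even_gt0 //=; apply/eqP => a0;
    move: ab; rewrite a0 mul0r ltxx.
  have [l00|l00] := eqVneq l 0; first by rewrite l00 mul0r addr0 subr0 mul1r.
  have lpos : 0 < l by rewrite lt0r l00 l0.
  by apply: ltr_wpDl; [rewrite mulr_ge0 // ltW | rewrite mulr_gt0].
have -> : (1 - l) * (a * a) + l * (a * b) = a * ((1 - l) * a + l * b) by ring.
by rewrite h mulr0 ltxx.
Qed.

Lemma straight_planar (G : sgraph) (pos : G -> R * R) :
  injective pos ->
  (forall x y z, uniq [:: x; y; z] -> det (pos x) (pos y) (pos z) != 0) ->
  (forall x y z w, adj x y -> adj z w -> uniq [:: x; y; z; w] ->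
     0 < det (pos x) (pos y) (pos z) * det (pos x) (pos y) (pos w) \/
     0 < det (pos z) (pos w) (pos x) * det (pos z) (pos w) (pos y)) ->
  planar R G.
Proof.
move=> posI gen sep.
have neq (x y : G) : adj x y -> x != y by apply: contraTneq => ->; rewrite adj_irrefl.
exists pos, (fun x y => segment (pos x) (pos y)); split=> //.
- move=> x y xy; split; first exact: segment_sym.
  by apply: segment_is_arc; rewrite (inj_eq posI) neq.
- move=> x y z /neq xy /det_segment d0; apply: contrapT => /not_orP[zx zy].
  suff u : uniq [:: x; y; z] by have := gen _ _ _ u; rewrite d0 eqxx.
  rewrite /= !inE !negb_or xy !andbT.
  by apply/andP; split; apply/eqP => e; [apply: zx|apply: zy].
have share x y z w u : adj x y -> adj z w -> (x, y) != (z, w) -> x = z ->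
    segment (pos x) (pos y) u -> segment (pos z) (pos w) u -> range pos u.
  move=> /neq xy /neq zw ne xz; rewrite -xz => h1 h2; exists x => //.
  rewrite (segments_common_end _ h1 h2) // gen //= !inE negb_or xy.
  move: ne zw; rewrite -xz xpair_eqE eqxx /= => -> ->; by [].
move=> x y z w xy zw n1 n2 u [h1 h2].
have yx : adj y x by rewrite adj_sym.
have wz : adj w z by rewrite adj_sym.
have [xz|nxz] := eqVneq x z; first exact: (share x y z w).
have [xw|nxw] := eqVneq x w.
  by apply: (share x y w z) => //; rewrite segment_sym.
have [yz|nyz] := eqVneq y z.
  apply: (share y x z w) => //; last by rewrite segment_sym.
  by apply: contra n2; rewrite !xpair_eqE andbC.
have [yw|nyw] := eqVneq y w.
  apply: (share y x w z) => //; try by rewrite segment_sym.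
  by apply: contra n1; rewrite !xpair_eqE andbC.
have u4 : uniq [:: x; y; z; w].
  by rewrite /= !inE !negb_or (neq _ _ xy) nxz nxw nyz nyw (neq _ _ zw).
case: (sep x y z w xy zw u4) => s; first by case: (segments_separated s h1).
by case: (segments_separated s h2).
Qed.

End StraightLine.

Definition co_rel (co : seq (nat * nat)) : rel nat :=
  fun i j => ((i, j) \in co) || ((j, i) \in co).

(** The vertices below [k] at the integer points [c], joined by straight segments
except for the pairs listed in [co], form a plane drawing: no three points are
collinear, and of two disjoint edges one lies on one side of the line through
the other. *)
Definition straight_ok (k : nat) (c : seq (int * int)) (co : seq (nat * nat)) :=
  (let pt := nth (0, 0) c in let I := iota 0 k in
  all (fun i => all (fun j => all (fun l =>
    uniq [:: i; j; l] ==> ((det (pt i) (pt j) (pt l) != 0) &&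
    all (fun m => [&& uniq [:: i; j; l; m], ~~ co_rel co i j & ~~ co_rel co l m] ==>
      ((0 < det (pt i) (pt j) (pt l) * det (pt i) (pt j) (pt m)) ||
       (0 < det (pt l) (pt m) (pt i) * det (pt l) (pt m) (pt j)))) I)) I) I) I)%R.

Section Patterns.
Variable R : realType.
Local Open Scope ring_scope.

Lemma pattern_planar k c co (G : sgraph) (f : G -> nat) :
  straight_ok k c co -> (2 < k)%N -> injective f -> (forall x, f x < k)%N ->
  (forall x y, adj x y -> ~~ co_rel co (f x) (f y)) -> planar R G.
Proof.
move=> ok k2 fI fk hco.
have inI i : (i < k)%N -> i \in iota 0 k by rewrite mem_iota.
pose pt := nth (0, 0) c : nat -> int * int.
pose pos i : R * R := ((pt i).1%:~R, (pt i).2%:~R).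
have detE i j l : det (pos i) (pos j) (pos l) = (det (pt i) (pt j) (pt l))%:~R.
  by rewrite /det /pos /= -!intrB -!intrM -intrB.
have gen i j l : (i < k)%N -> (j < k)%N -> (l < k)%N -> uniq [:: i; j; l] ->
    det (pt i) (pt j) (pt l) != 0.
  move=> /inI ik /inI jk /inI lk u.
  by move/allP: ok => /(_ i ik)/allP/(_ j jk)/allP/(_ l lk)/implyP/(_ u)/andP[].
apply: (@straight_planar R G (pos \o f)) => /=.
- move=> x y e; apply/eqP/negPn/negP => xy.
  (* Two equal points would be collinear with any third one. *)
  have [l lk u] : exists2 l, (l < k)%N & uniq [:: f x; f y; l].
    have [l ln] : exists l, l \in [seq i <- iota 0 k | (i != f x) && (i != f y)].
      have : (0 < size [seq i <- iota 0 k | (i != f x) && (i != f y)])%N.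
        have := count_predC (mem [:: f x; f y]) (iota 0 k).
        rewrite size_iota size_filter => e2; rewrite lt0n; apply/eqP => e0.
        have : (count (mem [:: f x; f y]) (iota 0 k) <= 2)%N.
          rewrite -size_filter; apply: (@uniq_leq_size _ _ [:: f x; f y]).
            by rewrite filter_uniq ?iota_uniq.
          by move=> i; rewrite mem_filter => /andP[].
        move: e2; rewrite (@eq_count _ (predC _) (fun i => (i != f x) && (i != f y))).
          by rewrite e0 addn0 => ->; rewrite leqNgt k2.
        by move=> i; rewrite /= !inE negb_or.
      by case: [seq _ <- _ | _] => // l s _; exists l; rewrite inE eqxx.
    move: ln; rewrite mem_filter mem_iota => /andP[/andP[lx ly] /andP[_ lk]].
    by exists l => //=; rewrite !inE negb_or (inj_eq fI) xy !(eq_sym _ l) lx ly.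
  have := gen _ _ _ (fk x) (fk y) lk u.
  have := detE (f x) (f y) l; rewrite -(e : pos (f x) = pos (f y)) {1}/det !subrr !mul0r subrr.
  by move/esym/eqP; rewrite intr_eq0 => ->.
- move=> x y z u; rewrite detE intr_eq0 gen //.
  by rewrite -[_ :: _]/(map f [:: x; y; z]) map_inj_uniq.
- move=> x y z w xy zw u; rewrite !detE -!intrM !ltr0z.
  have uf : uniq [:: f x; f y; f z; f w].
    by rewrite -[_ :: _]/(map f [:: x; y; z; w]) map_inj_uniq.
  have uf3 : uniq [:: f x; f y; f z].
    by move: uf; rewrite /= !inE !negb_or => /and4P[/and3P[-> -> _] /andP[-> _] _ _].
  move/allP: ok => /(_ _ (inI _ (fk x)))/allP/(_ _ (inI _ (fk y)))/allP.
  move=> /(_ _ (inI _ (fk z)))/implyP/(_ uf3)/andP[_ /allP/(_ _ (inI _ (fk w)))].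
  by rewrite uf !hco // => /orP.
Qed.

End Patterns.

(** The vertices outside [L] are few enough to be deleted, and what remains is a
subgraph of the graph drawn by the pattern. The graph [H] whose apexes are
wanted is allowed to be a subgraph of [G], so that one occurrence serves for
all subgraphs. *)
Lemma n_apex_pattern (R : realType) (n k : nat) c co (G H : sgraph) (phi : H -> G) (L : seq G) :
  straight_ok k c co -> (2 < k)%N -> (#|G| <= n + k)%N ->
  injective phi -> (forall x y, adj x y -> adj (phi x) (phi y)) ->
  uniq L -> size L = k ->
  {in L &, forall x y, adj x y -> ~~ co_rel co (index x L) (index y L)} ->
  n_apex R n H.
Proof.
move=> ok k2 cG phiI phiE uL sL hL.
pose S := [set h | phi h \notin L]; exists S.
  rewrite -(card_imset _ phiI) -(leq_add2r k) (leq_trans _ cG) //.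
  have <- : #|[set x in L]| = k by rewrite cardsE (card_uniqP _) // sL.
  rewrite -(cardsC [set x in L]) addnC leq_add2l subset_leq_card //.
  by apply/fintype.subsetP => _ /imsetP[h hS ->]; move: hS; rewrite !inE.
have inL (u : delete_vertices S) : phi (val u) \in L.
  by have := valP u; rewrite inE negbK.
apply: (@pattern_planar R k c co (delete_vertices S)
  (fun u => index (phi (val u)) L) ok k2) => //.
- move=> u v e; apply/val_inj/phiI.
  by rewrite -(nth_index (phi (val u)) (inL u)) e nth_index.
- by move=> u; rewrite -sL index_mem.
- by move=> u v uv; apply: hL => //; apply: phiE.
Qed.

(** * Minors *)

Section Minors.
Implicit Types G H S C : sgraph.

Lemma isomorphic_subgraph H G : isomorphic H G -> subgraph H G.
Proof. by move=> [f /bij_inj fI fE]; exists f => // x y; rewrite fE. Qed.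

Lemma isomorphic_card H G : isomorphic H G -> #|H| = #|G|.
Proof. by move=> [f fB _]; exact: bij_eq_card fB. Qed.

Lemma subgraph_trans H S G : subgraph H S -> subgraph S G -> subgraph H G.
Proof.
move=> [f fI fE] [g gI gE]; exists (g \o f); first exact: inj_comp.
by move=> x y /fE/gE.
Qed.

Lemma subgraph_card H G : subgraph H G -> #|H| <= #|G|.
Proof. by move=> [f fI _]; exact: leq_card fI. Qed.

Lemma card_contract_edge G (x y : G) : #|contract_edge x y|.+1 = #|G|.
Proof.
by rewrite card_sig -(cardC (pred1 y)) card1 add1n.
Qed.

Lemma contraction_cases G C : contraction G C ->
  [\/ C = G, exists x y : G, adj x y /\ C = contract_edge x y | #|C|.+1 < #|G|].
Proof.
elim=> [|H x y _ IH xy]; first by constructor 1.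
have cH := card_contract_edge x y.
case: IH => [eH|[u [v [uv eH]]]|lt].
- by subst H; constructor 2; exists x, y.
- by constructor 3; rewrite cH eH -(card_contract_edge u v).
- by constructor 3; rewrite cH (ltn_trans (ltnSn _)).
Qed.

Lemma contraction_card G C : contraction G C -> #|C| <= #|G|.
Proof.
elim=> // H x y _ IH _; rewrite (leq_trans _ IH) //.
by rewrite -(card_contract_edge x y).
Qed.

Lemma subgraph_contract_edge S G (f : S -> G) (x y : S) :
  injective f -> (forall u v, adj u v -> adj (f u) (f v)) ->
  subgraph (contract_edge x y) (contract_edge (f x) (f y)).
Proof.
move=> fI fE; have ne (u : contract_edge x y) : f (val u) != f y.
  by rewrite (inj_eq fI) (valP u).
exists (fun u => Sub (f (val u)) (ne u)) => [u v /(congr1 val)|u v].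
  by rewrite !SubK => /fI/val_inj.
rewrite /= /contract_adj /= => /andP[uv h]; apply/andP; split.
  by apply: contra uv => /eqP[/fI/val_inj->].
by case/or3P: h => [/fE->|/andP[/eqP-> /fE->]|/andP[/eqP-> /fE->]]; rewrite ?eqxx ?orbT.
Qed.

(** A minor on all vertices is a subgraph. If one vertex is lost, then either one
edge was contracted, or a vertex was deleted; deleting a vertex leaves fewer
edges than contracting an edge at that vertex. *)
Lemma minor_cases H G : (forall x : G, exists y, adj y x) -> minor H G ->
  [\/ subgraph H G /\ #|H| = #|G|,
      exists x y : G, adj x y /\ subgraph H (contract_edge x y) |
      #|H|.+1 < #|G|].
Proof.
move=> noiso [S [C [[f fI fE] SC HC]]].
have cH := isomorphic_card HC; have SG : #|S| <= #|G| by exact: leq_card fI.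
have CS := contraction_card SC.
have [eSG|nSG] := eqVneq #|S| #|G|; last first.
  have {nSG} SG' : #|S| < #|G| by rewrite ltn_neqAle nSG.
  case: (contraction_cases SC) => [eC|[x [y [xy eC]]]|lt]; first subst C; last first.
  - by constructor 3; rewrite cH (ltn_trans lt).
  - by constructor 3; rewrite cH eC card_contract_edge.
  constructor 2; have [z zf] : exists z, z \notin codom f.
    apply/existsP; rewrite -negb_forall; apply: contraTN SG' => /forallP all_f.
    rewrite -leqNgt -(card_codom fI); apply: subset_leq_card.
    by apply/fintype.subsetP => z _; exact: all_f.
  have [w wz] := noiso z; exists w, z; split=> //.
  have ne x : f x != z by apply: contra zf => /eqP<-; exact: codom_f.
  apply: subgraph_trans (isomorphic_subgraph HC) _.
  exists (fun x => Sub (f x) (ne x)) => [u v /(congr1 val)|u v uv].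
    by rewrite !SubK => /fI.
  rewrite /= /contract_adj /= fE // andbT; apply: contraTneq (fE _ _ uv) => -[->].
  by rewrite adj_irrefl.
case: (contraction_cases SC) => [eC|[x [y [xy eC]]]|lt].
- constructor 1; split; last by rewrite cH eC.
  by apply: subgraph_trans (isomorphic_subgraph HC) _; rewrite eC; exists f.
- constructor 2; exists (f x), (f y); split; first exact: fE.
  apply: subgraph_trans (isomorphic_subgraph HC) _; rewrite eC.
  exact: subgraph_contract_edge.
- by constructor 3; rewrite cH -eSG.
Qed.

Definition degree G (x : G) := #|[set y | adj x y]|.

(** [U] is the set of vertices that no contraction has touched. Each contraction
touches at most one more vertex of the result, creates no adjacency between
untouched vertices, and does not raise their degrees, as it merges neighbours. *)
Lemma contraction_untouched G C : contraction G C ->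
  exists (i : C -> G) (U : {set C}),
  [/\ injective i, #|~: U| + #|C| <= #|G|,
      {in U &, forall c d, adj c d -> adj (i c) (i d)} &
      {in U, forall c, degree c <= degree (i c)}].
Proof.
elim=> [|H x y _ [i [U [iI cU iE iD]]] xy].
  by exists id, [set: G]; split=> //; rewrite finset.setCT cards0.
have vI : injective (val : contract_edge x y -> H) by exact: val_inj.
exists (i \o val), [set u | (val u \in U) && (val u != x)]; split.
- exact: inj_comp.
- apply: leq_trans cU; rewrite -(card_contract_edge x y) addnS -addSn leq_add2r.
  rewrite -(card_imset _ vI) -add1n -(cards1 x); apply: leq_trans (leq_card_setU _ _); apply: subset_leq_card.
  apply/fintype.subsetP => _ /imsetP[u + ->]; rewrite !inE negb_and negbK.
  by rewrite orbC.
- move=> u v; rewrite !inE => /andP[uU /negPf ux] /andP[vU /negPf vx].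
  by rewrite /= /contract_adj ux vx !orbF => /andP[_]; exact: iE.
- move=> u; rewrite inE => /andP[uU ux]; apply: leq_trans (iD _ uU).
  pose back (v : contract_edge x y) : H :=
    if (val v == x) && ~~ adj (val u) x then y else val v.
  have backI : injective back.
    move=> v w; rewrite /back; case: ifP => [/andP[/eqP vx _]|_];
      case: ifP => [/andP[/eqP wx _]|_].
    + by move=> _; apply: vI; rewrite vx wx.
    + by move=> e; have := valP w; rewrite -e eqxx.
    + by move=> e; have := valP v; rewrite e eqxx.
    + exact: vI.
  rewrite /degree -(card_imset _ backI); apply: subset_leq_card.
  apply/fintype.subsetP => _ /imsetP[v + ->]; rewrite !inE /= /contract_adj (negPf ux) /=.
  rewrite /back => /andP[_ /orP[uv|/andP[/eqP vx yu]]].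
    by case: ifP => // /andP[/eqP vx]; rewrite -vx uv.
  case: ifP => [_|]; first by rewrite adj_sym.
  by rewrite [val v]vx eqxx => /negbFE.
Qed.

(** [W] is the set of vertices of [G] that survive untouched: they are pairwise
adjacent in the complete minor, hence already in [G], and their degrees in [G]
are at least those in the minor. At most [#|G| - m] of the [m] branch sets have
more than one vertex. *)
Lemma complete_minor_clique m G H : minor H G -> isomorphic H (complete_graph m) ->
  exists W : {set G}, [/\ m.*2 <= #|W| + #|G|,
    {in W &, forall x y, x != y -> adj x y} & {in W, forall x, m.-1 <= degree x}].
Proof.
move=> [S [C [[f fI fE] SC HC]]] HK.
have [h hI hE] : exists2 h : complete_graph m -> C, injective h &
    forall x y, adj (h x) (h y) = adj x y.
  case: HC => [p [p' pK p'K] pE]; case: HK => [q [q' qK q'K] qE].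
  exists (p \o q'); first by apply: inj_comp; exact: can_inj.
  by move=> x y /=; rewrite pE -qE !q'K.
have cC : #|C| = m.
  by rewrite -(isomorphic_card HC) (isomorphic_card HK) card_ord.
have hs : forall c, exists x, h x = c.
  have le : #|C| <= #|complete_graph m| by rewrite cC card_ord.
  by move=> c; have /codomP[x ->] := inj_card_onto hI le c; exists x.
have adjC (c d : C) : c != d -> adj c d.
  have [[x <-] [y <-]] := (hs c, hs d); rewrite (inj_eq hI) hE; exact.
have degC (c : C) : degree c = m.-1.
  rewrite /degree -cC -(cardsC1 c); apply: eq_card => d; rewrite !inE.
  by case: eqVneq => [->|dc]; rewrite ?adj_irrefl // adjC // eq_sym.
have [i [U [iI cU iE iD]]] := contraction_untouched SC.
have fiI : injective (f \o i) by exact: inj_comp.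
exists [set f (i c) | c in U]; split.
- rewrite (card_imset _ fiI) -addnn; have := leq_card f fI.
  have := cardsC U; rewrite cC in cU *; move: cU.
  move: #|~: U| #|U| #|S| #|G| => a b s g a1 a2 a3.
  by rewrite (leq_trans _ (leq_add (leqnn b) (leq_trans a1 a3))) // addnA a2.
- move=> _ _ /imsetP[c cU' ->] /imsetP[d dU ->] ne; apply/fE/iE => //.
  by apply: adjC; apply: contra ne => /eqP->.
- move=> _ /imsetP[c cU' ->]; rewrite -(degC c) (leq_trans (iD _ cU')) //.
  rewrite /degree -(card_imset _ fI); apply: subset_leq_card.
  by apply/fintype.subsetP => _ /imsetP[d + ->]; rewrite !inE; exact: fE.
Qed.

End Minors.

(** * Graphs on few vertices *)

(** Coordinates of the vertices of a drawing, and the pairs that are not joined. *)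
Definition pattern : Type := seq (int * int) * seq (nat * nat).

Definition K5_minus_edge : pattern :=
  ([:: (4, 4); (5, 1); (0, 2); (5, 6); (4, 3)]%Z, [:: (0, 1)]).

Lemma K5_minus_edge_ok : straight_ok 5 K5_minus_edge.1 K5_minus_edge.2.
Proof. by vm_compute. Qed.

Lemma complete_isomorphic m (H : sgraph) : #|H| = m ->
  (forall u v : H, u != v -> adj u v) -> isomorphic H (complete_graph m).
Proof.
move=> cH full; exists (fun x => cast_ord cH (enum_rank x)).
  apply: (@inj_card_bij H 'I_m); last by rewrite card_ord cH.
  by move=> x y /cast_ord_inj/enum_rank_inj.
move=> x y; rewrite /= /complete_adj (inj_eq (@cast_ord_inj _ _ _)) (inj_eq enum_rank_inj).
by case: eqVneq => [->|/full->]; rewrite ?adj_irrefl.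
Qed.

(** With at most [n + 4] vertices, delete all but four; with [n + 5] vertices keep
two nonadjacent ones and three more. In the drawing of the complete graph on
five vertices minus the edge joining the vertices 0 and 1, the first case uses
the vertices from 1 on. *)
Lemma n_apex_small (R : realType) n (H : sgraph) : #|H| <= n + 5 ->
  ~ isomorphic H (complete_graph (n + 5)) -> n_apex R n H.
Proof.
rewrite leq_eqVlt => /orP[/eqP cH|cH _]; last first.
  pose S := [set x in take n (enum H)]; exists S.
    by rewrite cardsE (leq_trans (card_size _)) // size_take_min geq_minl.
  have inD (u : delete_vertices S) : val u \in drop n (enum H).
    have := mem_enum H (val u); rewrite -{1}(cat_take_drop n (enum H)) mem_cat.
    by have := valP u; rewrite inE => /negPf ->; rewrite inE.
  apply: (@pattern_planar R 5 _ _ (delete_vertices S)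
    (fun u => (index (val u) (drop n (enum H))).+1) K5_minus_edge_ok) => //.
  - move=> u v [e]; apply: val_inj.
    by rewrite -(nth_index (val u) (inD u)) e (nth_index _ (inD v)).
  - move=> u; have := inD u; rewrite -index_mem ltnS => /leq_trans; apply.
    by rewrite size_drop -cardE leq_subLR -ltnS -addnS.
move=> ncomp.
have [u [v [uv nadj]]] : exists u v : H, u != v /\ ~~ adj u v.
  case: (boolP [exists u, exists v, (u != v) && ~~ @adj H u v]).
    by move=> /existsP[u /existsP[v /andP[uv nadj]]]; exists u, v.
  rewrite negb_exists => /forallP h; case: ncomp; apply: complete_isomorphic => // u v uv.
  by have := h u; rewrite negb_exists => /forallP/(_ v); rewrite uv negbK.
pose A := ~: [set u; v]; pose L := u :: v :: take 3 (enum A).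
have notA x : x \in [set u; v] -> x \notin take 3 (enum A).
  by move=> xuv; apply/negP => /mem_take; rewrite mem_enum inE xuv.
have uL : uniq L.
  rewrite /= inE negb_or uv take_uniq ?enum_uniq // !notA //.
    by rewrite !inE eqxx orbT.
  by rewrite !inE eqxx.
have sL : size L = 5.
  have cA : #|A| = n + 3.
    by apply: (@addnI 2); have := cardsC [set u; v]; rewrite cards2 uv cH => ->; rewrite addnCA.
  by rewrite /= size_take_min -cardE cA (minn_idPl _) // leq_addl.
apply: (@n_apex_pattern R n 5 _ _ H H id L K5_minus_edge_ok) => //.
  by rewrite cH.
move=> x y _ _; rewrite /co_rel !inE /= !xpair_eqE => xy.
have e0 z : (index z L == 0) = (z == u) by rewrite /= [u == z]eq_sym; case: (z == u).
have e1 z : (index z L == 1) -> z = v.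
  by rewrite /=; case: (u == z) => //; case: (v =P z) => [->|].
rewrite !e0; apply/negP => /orP[]/andP[].
  by move=> /eqP xu /e1 yv; move: xy; rewrite xu yv (negPf nadj).
by move=> /eqP yu /e1 xv; move: xy; rewrite xv yu adj_sym (negPf nadj).
Qed.

(** * Patterns and labellings *)

Section DeleteEdge.
Variables (G : sgraph) (x y : G).

Definition delete_edge_adj : rel G :=
  fun u v => adj u v && ~~ (((u == x) && (v == y)) || ((u == y) && (v == x))).

Lemma delete_edge_sym : symmetric delete_edge_adj.
Proof. by move=> u v; rewrite /delete_edge_adj adj_sym orbC ![(v == _) && _]andbC. Qed.

Lemma delete_edge_irrefl : irreflexive delete_edge_adj.
Proof. by move=> u; rewrite /delete_edge_adj adj_irrefl. Qed.

Definition delete_edge : sgraph := SGraph delete_edge_sym delete_edge_irrefl.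

End DeleteEdge.

(** Plane triangulations on [k] vertices, with their missing edges: a graph on
[n + k] vertices is [n]-apex as soon as its complement contains the complement
of one of these. The missing edges form a path with three edges or a perfect
matching for six vertices, where there are no other triangulations, and three
paths with two edges from a common end for seven, where there are others. *)
Definition patterns (k : nat) : seq pattern :=
  match k with
  | 5 => [:: K5_minus_edge]
  | 6 => [:: ([:: (7, 1); (4, 3); (5, 6); (6, 2); (1, 3); (5, 5)]%Z,
              [:: (0, 1); (1, 2); (2, 3)]);
             ([:: (2, 4); (7, 3); (3, 5); (0, 1); (5, 3); (2, 7)]%Z,
              [:: (0, 1); (2, 3); (4, 5)])]
  | 7 => [:: ([:: (4, 3); (0, 6); (8, 6); (5, 5); (6, 4); (1, 5); (4, 1)]%Z,
              [:: (0, 1); (0, 2); (0, 3); (1, 4); (2, 5); (3, 6)])]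
  | _ => [::]
  end.

Lemma patterns_ok k p : p \in patterns k -> straight_ok k p.1 p.2 && (2 < k).
Proof.
have all_ok : all (fun k => all (fun p => straight_ok k p.1 p.2) (patterns k)) (iota 5 3).
  by vm_compute.
case: (boolP (k \in iota 5 3)) => [kI pk|].
  by move/allP: all_ok => /(_ k kI)/allP/(_ p pk) ->; move: kI; rewrite mem_iota => /andP[/ltnW/ltnW].
move=> nk; suff -> : patterns k = [::] by [].
by case: k nk => [|[|[|[|[|[|[|[|k]]]]]]]].
Qed.

Section Search.
Variables (A : rel nat) (co : seq (nat * nat)) (cands : seq nat).

Fixpoint first_some (f : nat -> option (seq nat)) (s : seq nat) : option (seq nat) :=
  if s is x :: s' then (if f x is Some r then Some r else first_some f s') else None.

(** Backtracking search for vertices whose nonadjacencies cover [co]; its answer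
is checked afterwards by [occurrence]. *)
Fixpoint find_pattern (k : nat) (acc : seq nat) : option (seq nat) :=
  if k is k'.+1 then
    first_some (fun c =>
      if c \in acc then None else
      if all_lazy (fun a => if co_rel co a (size acc) then ~~ A (nth 0 acc a) c else true)
           (iota 0 (size acc))
      then find_pattern k' (rcons acc c) else None) cands
  else Some acc.

Definition occurrence (k : nat) (L : seq nat) : bool :=
  [&& uniq L, size L == k, all (mem cands) L &
      all (fun a => all (fun b => A a b ==> ~~ co_rel co (index a L) (index b L)) L) L].

Definition occurs (k : nat) : bool :=
  if find_pattern k [::] is Some L then occurrence k L else false.

End Search.

Definition has_pattern (A : rel nat) (cands : seq nat) (k : nat) : bool :=
  has_lazy (fun p => occurs A p.2 cands k) (patterns k).

Lemma lift_seq (T : Type) (f : T -> nat) (L : seq nat) :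
  (forall c, c \in L -> exists x, f x = c) -> exists L', map f L' = L.
Proof.
elim: L => [|c L IHL] h; first by exists [::].
have [|L' <-] := IHL; first by move=> d dL; apply: h; rewrite inE dL orbT.
have [|x <-] := h c; first by rewrite inE eqxx.
by exists (x :: L').
Qed.

Lemma n_apex_has_pattern (R : realType) n k (A : rel nat) cands (G H : sgraph)
    (f : G -> nat) :
  subgraph H G -> #|G| <= n + k -> injective f ->
  (forall x y, adj x y -> A (f x) (f y)) ->
  (forall c, c \in cands -> exists x, f x = c) ->
  has_pattern A cands k -> n_apex R n H.
Proof.
move=> [phi phiI phiE] cG fI fE onto; rewrite /has_pattern has_lazyE => /hasP[p pk].
have /andP[pok k2] := patterns_ok pk.
rewrite /occurs; case: find_pattern => // L /and4P[uL /eqP sL /allP Lc /allP hL].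
have [|L' eL] := @lift_seq _ f L; first by move=> c /Lc; exact: onto.
apply: (@n_apex_pattern R n k p.1 p.2 G H phi L' pok k2 cG phiI phiE).
- by move: uL; rewrite -eL; exact: map_uniq.
- by rewrite -sL -eL size_map.
- move=> x y xL yL xy; have ix z : index z L' = index (f z) L.
    by rewrite -eL index_map.
  have inL z : z \in L' -> f z \in L by rewrite -eL; exact: map_f.
  by rewrite !ix; have /allP/(_ _ (inL _ yL))/implyP := hL _ (inL _ xL); apply; exact: fE.
Qed.

(** [G] is isomorphic to the subgraph of the infinite graph [A] on the natural
numbers that is induced by an initial segment. *)
Definition labelling (A : rel nat) (G : sgraph) (f : G -> nat) : Prop :=
  [/\ injective f, forall x, f x < #|G| & forall x y, adj x y = A (f x) (f y)].

Lemma label_onto A (G : sgraph) (f : G -> nat) : labelling A f ->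
  forall i, i < #|G| -> exists x, f x = i.
Proof.
move=> [fI fb _] i iG; pose g x := Ordinal (fb x).
have gI : injective g by move=> x y /(congr1 val)/fI.
have /codomP[x /(congr1 val) e] := inj_card_onto gI (eq_leq (card_ord _)) (Ordinal iG).
by exists x.
Qed.

Definition swap (i j k : nat) : nat := if k == i then j else if k == j then i else k.

Lemma swapK i j : involutive (swap i j).
Proof.
move=> k; rewrite /swap; case: (eqVneq k i) => [->|ki].
  by rewrite eqxx; case: eqP.
by case: (eqVneq k j) => [->|kj]; rewrite ?eqxx // (negPf ki) (negPf kj).
Qed.

(** Vertices of the same class have the same neighbours, apart from themselves,
so they may be exchanged. *)
Definition twin_classes (A : rel nat) (cl : nat -> nat) : Prop :=
  forall i j k, cl i = cl j -> k != i -> k != j -> A i k = A j k.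

(** Exchange the labels [f x] and [l], which belong to twins. *)
Lemma relabel A cl (G : sgraph) (f : G -> nat) x l :
  symmetric A -> irreflexive A -> twin_classes A cl -> labelling A f ->
  cl (f x) = cl l -> l < #|G| ->
  exists f' : G -> nat, [/\ labelling A f', f' x = l,
    forall y, cl (f' y) = cl (f y) & forall y, y != x -> f y != l -> f' y = f y].
Proof.
move=> As Ai tw [fI fb fE] cx lG; exists (swap (f x) l \o f); split.
- split.
  + by apply: inj_comp => //; exact: (can_inj (swapK _ _)).
  + by move=> y; rewrite /= /swap; case: ifP => // _; case: ifP.
  + move=> y z; rewrite fE /=.
    have tw1 k : k != f x -> k != l -> A (f x) k = A l k by exact: tw.
    have tw2 k : k != f x -> k != l -> A k (f x) = A k l.
      by move=> k1 k2; rewrite As tw1 // As.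
    have [elx|nlx] := eqVneq l (f x).
      have sw1 k : swap (f x) l k = k.
        by rewrite /swap elx; case: (eqVneq k (f x)) => [->|].
      by rewrite !sw1.
    rewrite /swap; case: (eqVneq (f y) (f x)) => [->|yx];
      case: (eqVneq (f z) (f x)) => [->|zx]; rewrite ?Ai //.
    * by case: (eqVneq (f z) l) => [->|zl]; [rewrite As | rewrite tw1].
    * by case: (eqVneq (f y) l) => [->|yl]; [rewrite As | rewrite tw2].
    * case: (eqVneq (f y) l) => [->|yl]; case: (eqVneq (f z) l) => [->|zl];
        rewrite ?Ai //; [by rewrite tw1 | by rewrite tw2].
- by rewrite /= /swap eqxx.
- move=> y; rewrite /= /swap; case: eqP => [->|_]; first by rewrite cx.
  by case: eqP => // ->.
- by move=> y yx yl; rewrite /= /swap (inj_eq fI) (negPf yx) (negPf yl).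
Qed.

Lemma relabel2 A cl (G : sgraph) (f : G -> nat) x y l m :
  symmetric A -> irreflexive A -> twin_classes A cl -> labelling A f ->
  x != y -> l != m -> cl (f x) = cl l -> cl (f y) = cl m -> l < #|G| -> m < #|G| ->
  exists f' : G -> nat, [/\ labelling A f', f' x = l, f' y = m &
    forall z, cl (f' z) = cl (f z)].
Proof.
move=> As Ai tw fL xy lm cx cy lG mG.
have [f1 [f1L f1x f1c f1e]] := relabel As Ai tw fL cx lG.
have [|f2 [f2L f2y f2c f2e]] := relabel (x := y) As Ai tw f1L _ mG; first by rewrite f1c.
exists f2; split=> //.
- by rewrite f2e // f1x.
- by move=> z; rewrite f2c f1c.
Qed.

Lemma relabel3 A cl (G : sgraph) (f : G -> nat) x y z l m o :
  symmetric A -> irreflexive A -> twin_classes A cl -> labelling A f ->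
  uniq [:: x; y; z] -> uniq [:: l; m; o] ->
  cl (f x) = cl l -> cl (f y) = cl m -> cl (f z) = cl o ->
  [/\ l < #|G|, m < #|G| & o < #|G|] ->
  exists f' : G -> nat, [/\ labelling A f', f' x = l, f' y = m & f' z = o].
Proof.
move=> As Ai tw fL; rewrite /= !inE !negb_or => /and3P[/andP[xy xz] yz _].
move=> /and3P[/andP[lm lo] mo _] cx cy cz [lG mG oG].
have [f1 [f1L f1x f1y f1c]] := relabel2 As Ai tw fL xy lm cx cy lG mG.
have [|f2 [f2L f2z f2c f2e]] := relabel (x := z) As Ai tw f1L _ oG; first by rewrite f1c.
by exists f2; split=> //; rewrite f2e ?f1x ?f1y.
Qed.

(** * Graphs with a final segment of twins *)

Definition delete_edge_rel (A : rel nat) (i j : nat) : rel nat :=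
  fun a b => A a b && ~~ (((a == i) && (b == j)) || ((a == j) && (b == i))).

Definition contract_edge_rel (A : rel nat) (i j : nat) : rel nat :=
  fun a b => [|| A a b, (a == i) && A j b | (b == i) && A j a].

Definition edge_test (A : rel nat) (k N i j : nat) : bool :=
  if has_pattern (delete_edge_rel A i j) (iota 0 N) k then
    if k == 7 then has_pattern (contract_edge_rel A i j) (rem j (iota 0 N)) 6
    else true
  else false.

(** For every edge, the graph without that edge is [n]-apex by a pattern, and so
is, for [k = 7], the graph with that edge contracted. The search for neighbours
of [i] excludes isolated vertices. *)
Definition edges_test (A : rel nat) (k N : nat) : bool :=
  all_lazy (fun i =>
    if has (A i) (iota 0 N) then
      all_lazy (fun j => if A i j then edge_test A k N i j else true) (iota 0 N)
    else false) (iota 0 N).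

(** Beyond the first [s] vertices all vertices are twins, and an edge involves at
most two of them. So graphs larger than the last size contain nothing new; those
below the first have less than [s] vertices or violate [n > 0]. *)
Definition sizes (s k : nat) : seq nat :=
  let lo := maxn s k.+1 in iota lo (maxn s.+2 k.+1 - lo).+1.

(** The bound 5 is the least possible value of [n + 4]. *)
Definition low_degree (A : rel nat) (s i : nat) : bool :=
  ~~ A i s && (count (A i) (iota 0 s) < 5).

(** A complete minor on [n + 5] vertices would leave a clique of vertices of
degree at least [n + 4] that omits at most [2 k - 10] vertices. *)
Definition clique_test (A : rel nat) (s k : nat) : bool :=
  all (fun c => (size c.2 <= k.*2 - 10) ==>
    (has (fun i => has (fun j => (i != j) && ~~ A i j) c.1) c.1 ||
     has (low_degree A s) c.1)) (splits (iota 0 s)).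

(** After deleting [n] vertices at least [k] remain; up to exchange of twins these
are some of the first [s], completed by the vertices that follow. *)
Definition nonplanarity_test (A : rel nat) (s k : nat) : bool :=
  all_lazy (fun c => if size c.1 <= k then
      nonplanar_test k A (c.1 ++ iota s (k - size c.1)) else true)
    (splits (iota 0 s)).

Definition template_test (A : rel nat) (s k : nat) : bool :=
  [&& all (edges_test A k) (sizes s k), (k == 5) || clique_test A s k &
      nonplanarity_test A s k].

Section Template.
Variables (R : realType) (A : rel nat) (s k n : nat) (G : sgraph) (f : G -> nat).
Hypotheses (As : symmetric A) (Ai : irreflexive A) (tw : twin_classes A (minn s)).
Hypotheses (fL : labelling A f) (cG : #|G| = n + k) (n0 : 0 < n) (sG : s <= #|G|).
Hypotheses (k57 : 5 <= k <= 7).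

Let cap := minn #|G| (maxn s.+2 k.+1).

Lemma cap_size : cap \in sizes s k.
Proof. by rewrite mem_iota /cap; lia. Qed.

(** The ends of an edge can be exchanged with twins of small label. *)
Lemma labelling_capped x y : x != y ->
  exists f' : G -> nat, [/\ labelling A f', f' x < cap & f' y < cap].
Proof.
move=> xy; have [fI fb _] := fL.
have bx := fb x; have by_ := fb y.
have nxy : f x != f y by rewrite (inj_eq fI).
pose l := minn (f x) s; pose m := if f y < s then f y else if f x < s then s else s.+1.
have [|||||f' [f'L f'x f'y _]] := @relabel2 A (minn s) G f x y l m As Ai tw fL xy;
  try (rewrite /l /m; do 2?case: (ltnP _ s) => ?; lia).
by exists f'; split=> //; rewrite ?f'x ?f'y /l /m /cap; clear f'L; do 2?case: (ltnP _ s) => ?; lia.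
Qed.

Lemma labels_below_cap (f' : G -> nat) : labelling A f' ->
  forall c, c \in iota 0 cap -> exists x, f' x = c.
Proof.
move=> f'L c; rewrite mem_iota => /andP[_ cc]; apply: (label_onto f'L).
exact: leq_trans cc (geq_minl _ _).
Qed.

Section NotApex.
Hypothesis nonplanar_ok : nonplanarity_test A s k.

(** Of the surviving vertices keep [k], with preference for labels below [s].
The map [h] sends a tested list of labels to them, fixing the labels below [s];
the others may be replaced by each other since they are twins. *)
Lemma not_n_apex : ~ n_apex R n G.
Proof.
move=> [S cS /planar_poly_drawing]; set V := delete_vertices S.
have [fI fb fE] := fL; pose lab (u : V) := f (val u).
have labI : injective lab by move=> u v /fI/val_inj.
have cV : k <= #|V|.
  have : #|V| = #|~: S| by rewrite card_sig -cardsE; apply: eq_card => x; rewrite !inE.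
  by have := cardsC S; move: cS cG; clear; lia.
have [x0 _] : exists x0 : V, true.
  by have /card_gt0P[x0 _] : 0 < #|V| by lia; exists x0.
pose specials := [seq i <- iota 0 s | i \in [seq lab u | u <- enum V]].
pose rest := [seq u <- enum V | s <= lab u].
have cVs : #|V| <= size specials + size rest.
  rewrite cardE -(count_predC (fun u => s <= lab u)) addnC [size rest]size_filter leq_add2r.
  rewrite -size_filter -(size_map lab); apply: uniq_leq_size.
    by rewrite (map_inj_uniq labI); apply: filter_uniq; exact: enum_uniq.
  move=> _ /mapP[u + ->]; rewrite mem_filter /= -ltnNge => /andP[us uV].
  by rewrite mem_filter map_f //= mem_iota.
pose K := take k specials.
have Ksub : subseq K (iota 0 s).
  by apply: subseq_trans (filter_subseq _ _); exact: take_subseq.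
have Ksplit : (K, [seq i <- iota 0 s | i \notin K]) \in splits (iota 0 s).
  have := filter_splits (mem K) (iota 0 s).
  by rewrite -(subseq_uniqP (iota_uniq 0 s) Ksub).
have sK : size K <= k by rewrite size_take_min geq_minl.
have restK : k - size K <= size rest.
  by rewrite /K size_take_min; move: cV cVs; clear; lia.
have := nonplanar_ok; rewrite /nonplanarity_test all_lazyE => /allP/(_ _ Ksplit) /=.
rewrite sK => test.
set L := K ++ iota s (k - size K) in test.
have Ks i : i \in K -> i < s.
  by move=> /(mem_subseq Ksub); rewrite mem_iota.
have uL : uniq L.
  rewrite cat_uniq (subseq_uniq Ksub) ?iota_uniq // andbT.
  apply/hasPn => i; rewrite mem_iota => /andP[si _].
  by apply: contraTN si => /Ks; rewrite -ltnNge.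
have sL : size L = k by rewrite size_cat size_iota subnKC.
have vertex_of i : {u : V | i \in K -> lab u = i}.
  case: (boolP (i \in K)) => iK; last by exists x0.
  have iV : i \in [seq lab u | u <- enum V].
    by move: (mem_take iK); rewrite mem_filter => /andP[].
  by exists (nth x0 (enum V) (index i [seq lab u | u <- enum V])) => _;
    rewrite -(nth_map x0 0) ?nth_index // -(size_map lab) index_mem.
pose h i : V := if i < s then sval (vertex_of i) else nth x0 rest (i - s).
have Lrest i : i \in L -> s <= i -> i - s < size rest.
  rewrite mem_cat mem_iota => /orP[/Ks|]; first by move=> ? ?; lia.
  by move: restK; clear; lia.
have hK i : i \in L -> i < s -> lab (h i) = i.
  rewrite mem_cat mem_iota => /orP[iK is_|]; last by clear; lia.
  by rewrite /h is_; exact: (svalP (vertex_of i)).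
have hR i : i \in L -> s <= i -> s <= lab (h i).
  move=> iL si; rewrite /h ltnNge si /=.
  by have := mem_nth x0 (Lrest _ iL si); rewrite mem_filter => /andP[].
have urest : uniq rest by apply: filter_uniq; exact: enum_uniq.
have hI : {in L &, injective h}.
  move=> i j iL jL e; have [is_|si] := ltnP i s; have [js|sj] := ltnP j s.
  - by rewrite -(hK i) // e hK.
  - by have := hR _ jL sj; rewrite -e hK // leqNgt is_.
  - by have := hR _ iL si; rewrite e hK // leqNgt js.
  - move: e; rewrite /h !ltnNge si sj /= => /eqP.
    rewrite nth_uniq ?Lrest // => /eqP.
    by clear -si sj; lia.
have k57' : 5 <= k <= 7 by [].
move=> dr; apply: (@nonplanar_test_sound R k A L k57' uL sL test).
apply: (poly_drawing_map (h := h)) dr => //; first by move=> i _; rewrite mem_enum.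
have twR i a b : s <= a -> s <= b -> i != a -> i != b -> A i a = A i b.
  by move=> sa sb ia ib; rewrite !(As i); apply: tw; rewrite ?(minn_idPl sa) ?(minn_idPl sb).
move=> i j iL jL ij; have nij : i != j by apply: contraTneq ij => ->; rewrite Ai.
have nh : lab (h i) != lab (h j) by rewrite (inj_eq labI) (inj_in_eq hI).
change (adj (val (h i)) (val (h j))); rewrite fE -/(lab (h i)) -/(lab (h j)).
(* Two labels above all others serve as intermediate twins when both ends move. *)
pose t := (s + i + j + lab (h i) + lab (h j)).+1.
have [is_|si] := ltnP i s; have [js|sj] := ltnP j s.
- by rewrite !hK.
- have hj := hR _ jL sj; rewrite (hK i) // -(twR i j (lab (h j))) //.
  by rewrite ltn_eqF // (leq_trans is_).
- have hi := hR _ iL si; rewrite (hK j) // As -(twR j i (lab (h i))) //.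
  + by rewrite As.
  + by rewrite eq_sym.
  + by rewrite ltn_eqF // (leq_trans js).
- have hi := hR _ iL si; have hj := hR _ jL sj.
  rewrite (twR _ _ t) //; try by rewrite /t; clear; lia.
  rewrite As (twR _ _ t.+1) //; try by rewrite /t; clear; lia.
  move: ij; rewrite (twR _ _ t) //; try by rewrite /t; clear -sj; lia.
  by rewrite As (twR _ _ t.+1) //; rewrite /t; clear -si; lia.
Qed.

End NotApex.

Hypothesis edges_ok : all (edges_test A k) (sizes s k).

Lemma edge_testP (f' : G -> nat) (x y : G) : labelling A f' -> adj x y ->
  f' x < cap -> f' y < cap -> edge_test A k cap (f' x) (f' y).
Proof.
move=> [_ _ f'E] xy xc yc; have := allP edges_ok _ cap_size.
rewrite /edges_test all_lazyE => /allP/(_ (f' x)).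
rewrite mem_iota add0n xc => /(_ isT); case: ifP => // _.
rewrite all_lazyE => /allP/(_ (f' y)); rewrite mem_iota add0n yc => /(_ isT).
by rewrite -f'E xy.
Qed.

Lemma no_isolated (x : G) : exists y, adj y x.
Proof.
have [y yx] : exists y : G, y != x.
  apply/existsP; apply: contraT; rewrite negb_exists => /forallP all_x.
  have : #|G| <= 1 by rewrite -(cards1 x) -cardsT; apply: subset_leq_card;
    apply/fintype.subsetP => y _; rewrite inE; have := all_x y; rewrite negbK.
  by rewrite cG; lia.
have [f' [f'L _ xc]] := labelling_capped yx; have [_ _ f'E] := f'L.
have := allP edges_ok _ cap_size.
rewrite /edges_test all_lazyE => /allP/(_ (f' x)).
rewrite mem_iota add0n xc => /(_ isT); case: ifP => // /hasP[j /(labels_below_cap f'L)[z <-]].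
by rewrite -f'E adj_sym => zx _; exists z.
Qed.

Lemma n_apex_delete_edge (H : sgraph) (x y : G) : adj x y -> subgraph H (delete_edge x y) -> n_apex R n H.
Proof.
move=> xy HG; have xny : x != y by apply: contraTneq xy => ->; rewrite adj_irrefl.
have [f' [f'L xc yc]] := labelling_capped xny; have [f'I _ f'E] := f'L.
have := edge_testP f'L xy xc yc; rewrite /edge_test; case: ifP => // pat _.
apply: (@n_apex_has_pattern R n k _ _ (delete_edge x y) H f' HG _ f'I _
  (labels_below_cap f'L) pat); first by rewrite -cG.
move=> u v; rewrite /= /delete_edge_adj /delete_edge_rel f'E => /andP[-> h].
by rewrite !(inj_eq f'I).
Qed.

Lemma n_apex_contract_edge (H : sgraph) (x y : G) : k = 7 -> adj x y ->
  subgraph H (contract_edge x y) -> n_apex R n H.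
Proof.
move=> k7 xy HG; have xny : x != y by apply: contraTneq xy => ->; rewrite adj_irrefl.
have [f' [f'L xc yc]] := labelling_capped xny; have [f'I _ f'E] := f'L.
have := edge_testP f'L xy xc yc; rewrite /edge_test; case: ifP => // _.
rewrite {1}k7 eqxx => pat.
apply: (@n_apex_has_pattern R n 6 _ _ (contract_edge x y) H (fun u => f' (val u))
  HG _ _ _ _ pat).
- by have := card_contract_edge x y; rewrite cG k7 addnS => -[->].
- by move=> u v /f'I/val_inj.
- move=> u v; rewrite /= /contract_adj /contract_edge_rel !f'E => /andP[_].
  by rewrite !(inj_eq f'I).
- move=> c; rewrite mem_rem_uniq ?iota_uniq // inE => /andP[cy cI].
  have [z zc] := labels_below_cap f'L cI.
  have zy : z != y by apply: contra cy => /eqP<-; rewrite zc.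
  by exists (Sub z zy); rewrite SubK.
Qed.

Hypothesis clique_ok : (k == 5) || clique_test A s k.

(** A vertex that is not adjacent to the twins from [s] on has all its neighbours
below [s]. *)
Lemma low_degree_bound x : f x < s -> low_degree A s (f x) -> degree x < 5.
Proof.
move=> xs /andP[nAs lt]; apply: leq_ltn_trans lt; have [fI fb fE] := fL.
rewrite /degree cardE -size_filter -(size_map f).
apply: uniq_leq_size; first by rewrite map_inj_uniq ?enum_uniq.
move=> _ /mapP[y + ->]; rewrite mem_enum inE fE mem_filter mem_iota => xy.
rewrite xy /= add0n ltnNge; apply: contraNN nAs => sy.
rewrite As (tw (j := f y)); first by rewrite As.
- by rewrite (minn_idPl (leqnn s)) (minn_idPl sy).
- by rewrite ltn_eqF.
- by rewrite ltn_eqF // (leq_trans xs).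
Qed.

Lemma no_complete_minor (H : sgraph) : 5 < k -> minor H G -> ~ isomorphic H (complete_graph (n + 5)).
Proof.
move=> k5 HG /(complete_minor_clique HG)[W [cW Wadj Wdeg]]; have [fI fb fE] := fL.
pose p i := i \in [seq f x | x <- enum W].
have pf x : p (f x) = (x \in W).
  by apply/mapP/idP => [[y + /fI->]|xW]; [rewrite mem_enum | exists x; rewrite ?mem_enum].
have := allP (_ : clique_test A s k) _ (filter_splits p (iota 0 s)).
have -> : clique_test A s k by move: clique_ok; rewrite gtn_eqF.
move=> /(_ isT)/implyP /=.
have sz : size [seq x <- iota 0 s | ~~ p x] <= k.*2 - 10.
  apply: (@leq_trans #|~: W|); last by have := cardsC W; move: cW; rewrite cG; lia.
  rewrite cardE -(size_map f); apply: uniq_leq_size; first by rewrite filter_uniq ?iota_uniq.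
  move=> i; rewrite mem_filter mem_iota => /andP[npi /andP[_ is_]].
  have [x xi] := label_onto fL (leq_trans is_ sG); rewrite -xi map_f //.
  by rewrite mem_enum inE -pf xi.
move=> /(_ sz)/orP[]/hasP[i]; rewrite mem_filter mem_iota => /andP[/mapP[x + ->] /andP[_ xs]];
  rewrite mem_enum => xW.
  move=> /hasP[j]; rewrite mem_filter => /andP[/mapP[y + ->] _]; rewrite mem_enum => yW.
  by rewrite (inj_eq fI) -fE => /andP[xy]; rewrite Wadj.
move=> /(low_degree_bound xs); have := Wdeg _ xW; move: (degree x) => d.
by move: n0; clear; lia.
Qed.

(** A proper minor either misses an edge of [G] on the same vertex set, or lies
in [G] with one edge contracted, or has so few vertices that only the complete
graph on [n + 5] vertices could fail to be [n]-apex. *)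
Lemma proper_minor_n_apex (H : sgraph) : proper_minor H G -> n_apex R n H.
Proof.
move=> [HG nHG].
have small : #|H| <= n + 5 -> ~ isomorphic H (complete_graph (n + 5)) -> n_apex R n H.
  exact: n_apex_small.
have below : 5 < k -> #|H| <= n + 5 -> n_apex R n H.
  by move=> k5 cH; apply: small => //; exact: no_complete_minor.
case: (minor_cases no_isolated HG) => [[[phi phiI phiE] cHG]|[x [y [xy HC]]]|lt].
- have phiB : bijective phi by apply: inj_card_bij; rewrite ?cHG.
  have [|full] := boolP [exists u, exists v, ~~ adj u v && adj (phi u) (phi v)].
    move=> /existsP[u /existsP[v /andP[nuv uv]]].
    apply: (n_apex_delete_edge uv); exists phi => // a b ab.
    rewrite /= /delete_edge_adj phiE //= !(inj_eq phiI).
    apply: contra nuv => /orP[]/andP[/eqP ea /eqP eb]; move: ab; rewrite ea eb //.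
    by rewrite adj_sym.
  case: nHG; exists phi => // u v; apply/idP/idP; last exact: phiE.
  move: full; rewrite negb_exists => /forallP/(_ u); rewrite negb_exists => /forallP/(_ v).
  by rewrite negb_and negbK => /orP[//|/negPf->].
- have cH : #|H| < #|G|.
    rewrite -(card_contract_edge x y) ltnS; exact: subgraph_card HC.
  have [k7|k7] := eqVneq k 7; first exact: (n_apex_contract_edge k7 xy).
  have [k5|k6] := ltnP 5 k; first by apply: below => //; move: cH; rewrite cG; lia.
  apply: small; first by move: cH; rewrite cG; lia.
  by move=> /isomorphic_card; rewrite card_ord => e; move: cH; rewrite e cG; lia.
- have [k5|k6] := ltnP 5 k; first by apply: below => //; move: lt; rewrite cG; lia.
  apply: small; first by move: lt; rewrite cG; lia.
  by move=> /isomorphic_card; rewrite card_ord => e; move: lt; rewrite e cG; lia.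
Qed.

End Template.

Theorem template_in_O (R : realType) (A : rel nat) (s k n : nat) (G : sgraph)
    (f : G -> nat) :
  symmetric A -> irreflexive A -> twin_classes A (minn s) -> labelling A f ->
  #|G| = n + k -> 0 < n -> s <= #|G| -> 5 <= k <= 7 -> template_test A s k ->
  in_O R n G.
Proof.
move=> As Ai tw fL cG n0 sG k57 /and3P[e_ok c_ok n_ok]; split.
  exact: (not_n_apex As Ai tw fL cG n0 sG k57 n_ok).
by move=> H; exact: (proper_minor_n_apex R As Ai tw fL cG n0 sG k57 e_ok c_ok).
Qed.

(** * Triangle-Y moves on labelled graphs *)

(** The new vertex gets the label 0 and all others are shifted, so that the twins
remain a final segment. *)
Definition nabla_rel (A : rel nat) (t : seq nat) : rel nat := fun i j =>
  match i, j with
  | 0, 0 => false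
  | 0, j'.+1 => j' \in t
  | i'.+1, 0 => i' \in t
  | i'.+1, j'.+1 => A i' j' && ~~ ((i' \in t) && (j' \in t))
  end.

Lemma nabla_rel_sym A t : symmetric A -> symmetric (nabla_rel A t).
Proof. by move=> As [|i] [|j] //=; rewrite As andbC [X in _ && ~~ X]andbC andbC. Qed.

Lemma nabla_rel_irrefl A t : irreflexive A -> irreflexive (nabla_rel A t).
Proof. by move=> Ai [|i] //=; rewrite Ai. Qed.

Lemma twin_classes_refine A cl cl' : twin_classes A cl ->
  (forall i j, cl' i = cl' j -> cl i = cl j) -> twin_classes A cl'.
Proof. by move=> tw ref i j k /ref; exact: tw. Qed.

Lemma nabla_rel_twins A t s : twin_classes A (minn s) -> all (fun l => l < s) t ->
  twin_classes (nabla_rel A t) (minn s.+1).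
Proof.
move=> tw /allP ts i j k e ki kj.
have [->//|ij] := eqVneq i j.
have [si sj] : s < i /\ s < j by move: ij e; clear; lia.
have nt l : s <= l -> l \in t = false by move=> sl; apply/negP => /ts; rewrite ltnNge sl.
case: i si ij ki e => // i si ij ki e; case: j sj ij kj e => // j sj ij kj e.
rewrite /nabla_rel; case: k ki kj => [|k] ki kj; first by rewrite (nt i) ?(nt j).
rewrite (nt i) // (nt j) // !andbT.
by apply: tw; rewrite ?(minn_idPl (si : s <= i)) ?(minn_idPl (sj : s <= j)).
Qed.

Lemma labelling_isomorphic A (H G : sgraph) (f : G -> nat) :
  isomorphic H G -> labelling A f -> exists h : H -> nat, labelling A h.
Proof.
move=> HG [fI fb fE]; have cHG := isomorphic_card HG.
case: HG => [p /bij_inj pI pE]; exists (f \o p); split.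
- exact: inj_comp.
- by move=> x; rewrite cHG; exact: fb.
- by move=> x y; rewrite -pE fE.
Qed.

Lemma labelling_nabla A (G : sgraph) (f : G -> nat) (a b c : G) (t : seq nat) :
  labelling A f -> map f [:: a; b; c] =i t ->
  exists h : nablaY a b c -> nat, labelling (nabla_rel A t) h.
Proof.
move=> [fI fb fE] ft; exists (fun u => if u is Some x then (f x).+1 else 0).
have memE x : (x \in [:: a; b; c]) = (f x \in t) by rewrite -ft mem_map.
split.
- by move=> [x|] [y|] // [/fI->].
- by move=> [x|]; rewrite /= card_option ltnS.
- by move=> [x|] [y|] //=; rewrite ?memE // fE.
Qed.

Lemma perm_map_lift (T : eqType) (g : T -> nat) (s : seq T) (t : seq nat) :
  perm_eq (map g s) t -> exists2 s', perm_eq s s' & map g s' = t.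
Proof.
case: s => [|x s]; first by move=> /perm_size/esym/size0nil ->; exists [::].
rewrite perm_sym => /(perm_iotaP 0)[Is pI ->]; rewrite size_map in pI.
exists [seq nth x (x :: s) i | i <- Is].
  by rewrite perm_sym; apply/(perm_iotaP x); exists Is.
rewrite -map_comp; apply/eq_in_map => i iI; rewrite [RHS](nth_map x) //.
by move: iI; rewrite (perm_mem pI) mem_iota.
Qed.

(** Twins may be exchanged, so only the classes of the corners of the triangle
matter, and their order does not. *)
Lemma child_labelling A cl (G H : sgraph) (f : G -> nat) (ts : seq (seq nat)) :
  symmetric A -> irreflexive A -> twin_classes A cl -> labelling A f ->
  (forall i j k, A i j -> A j k -> A i k -> i < #|G| -> j < #|G| -> k < #|G| ->
    exists l m o, [/\ [:: l; m; o] \in ts, uniq [:: l; m; o],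
      [/\ l < #|G|, m < #|G| & o < #|G|] &
      perm_eq [:: cl i; cl j; cl k] [:: cl l; cl m; cl o]]) ->
  child H G ->
  exists l m o, [/\ [:: l; m; o] \in ts, [/\ l < #|G|, m < #|G| & o < #|G|],
    #|H| = #|G|.+1 & exists h : H -> nat, labelling (nabla_rel A [:: l; m; o]) h].
Proof.
move=> As Ai tw fL cases [a [b [c [ab bc ac HN]]]]; have [fI fb fE] := fL.
have := cases (f a) (f b) (f c); rewrite -!fE ab bc ac !fb.
move=> /(_ isT isT isT isT isT isT)[l [m [o [tsP ut bnd]]]].
move=> /(@perm_map_lift _ (fun x => cl (f x)) [:: a; b; c]) [s' ps]; case: s' ps => [|x [|y [|z [|? ?]]]] // ps [cx cy cz].
have neq (u v : G) : adj u v -> u != v by apply: contraTneq => ->; rewrite adj_irrefl.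
have us : uniq [:: x; y; z].
  by rewrite -(perm_uniq ps) /= !inE negb_or !neq.
have [f' [f'L f'x f'y f'z]] := relabel3 As Ai tw fL us ut cx cy cz bnd.
exists l, m, o; split=> //; first by rewrite (isomorphic_card HN) card_option.
have [|h hL] := @labelling_nabla A G f' a b c [:: l; m; o] f'L.
  move=> i; rewrite -f'x -f'y -f'z -[[:: f' x; _; _]]/(map f' [:: x; y; z]).
  by apply: perm_mem; exact: perm_map.
exact: labelling_isomorphic HN hL.
Qed.

Definition neq_rel : rel nat := fun i j => i != j.

Definition K_child_rel := nabla_rel neq_rel [:: 0; 1; 2].

(** The labels 0, 1, 2 and 3, 4, 5 form the two large parts; the value 2 collects
the singleton parts. *)
Definition part (i : nat) : nat := if i < 3 then 0 else if i < 6 then 1 else 2.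

Definition K33_1_rel : rel nat :=
  fun i j => (i != j) && ~~ ((part i == part j) && (part i < 2)).

(** The new vertex, the corners of the former triangle, and all other vertices. *)
Definition K_child_class (i : nat) : nat := if i == 0 then 0 else if i < 4 then 1 else 2.

Lemma neq_sym : symmetric neq_rel. Proof. by move=> i j; rewrite /neq_rel eq_sym. Qed.
Lemma neq_irrefl : irreflexive neq_rel. Proof. by move=> i; rewrite /neq_rel eqxx. Qed.

Lemma K33_1_rel_sym : symmetric K33_1_rel.
Proof.
move=> i j; rewrite /K33_1_rel eq_sym; congr (_ && ~~ _).
by case: eqVneq => [->|]; rewrite ?eqxx // => /negPf; rewrite eq_sym => ->.
Qed.

Lemma K33_1_rel_irrefl : irreflexive K33_1_rel.
Proof. by move=> i; rewrite /K33_1_rel eqxx. Qed.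

Lemma neq_twins : twin_classes neq_rel (fun=> 0).
Proof. by move=> i j k _ ki kj; rewrite /neq_rel eq_sym ki eq_sym kj. Qed.

Lemma K33_1_twins : twin_classes K33_1_rel part.
Proof.
by move=> i j k e ki kj; rewrite /K33_1_rel e eq_sym ki [j == k]eq_sym kj.
Qed.

Lemma K_child_twins : twin_classes K_child_rel K_child_class.
Proof.
move=> i j k; rewrite /K_child_rel /nabla_rel /neq_rel /K_child_class.
case: i => [|[|[|[|i]]]]; case: j => [|[|[|[|j]]]]; case: k => [|[|[|[|k]]]] //=;
  rewrite ?eqSS => _ ki kj; rewrite ?inE ?andbT //= ?ki ?kj //.
all: by rewrite ![_ == k]eq_sym ki kj.
Qed.

Lemma complete_test : template_test neq_rel 0 5.
Proof. by vm_compute. Qed.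
Lemma K_child_test : template_test K_child_rel 4 6.
Proof. by vm_compute. Qed.
Lemma K_grandchild_test1 : template_test (nabla_rel K_child_rel [:: 1; 4; 5]) 7 7.
Proof. by vm_compute. Qed.
Lemma K_grandchild_test2 : template_test (nabla_rel K_child_rel [:: 4; 5; 6]) 8 7.
Proof. by vm_compute. Qed.
Lemma K33_1_test : template_test K33_1_rel 6 6.
Proof. by vm_compute. Qed.
Lemma K33_1_child_test1 : template_test (nabla_rel K33_1_rel [:: 0; 3; 6]) 8 7.
Proof. by vm_compute. Qed.
Lemma K33_1_child_test2 : template_test (nabla_rel K33_1_rel [:: 0; 6; 7]) 9 7.
Proof. by vm_compute. Qed.
Lemma K33_1_child_test3 : template_test (nabla_rel K33_1_rel [:: 3; 6; 7]) 9 7.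
Proof. by vm_compute. Qed.
Lemma K33_1_child_test4 : template_test (nabla_rel K33_1_rel [:: 6; 7; 8]) 10 7.
Proof. by vm_compute. Qed.

(** * The graphs of the theorem *)

Lemma complete_labelling m :
  labelling neq_rel (fun i : complete_graph m => nat_of_ord (i : 'I_m)).
Proof.
split=> [|i|//]; first exact: val_inj.
by rewrite card_ord.
Qed.

Definition K33_1_label n (u : K33_1 n) : nat :=
  let i := nat_of_ord (tag u) in if i < 2 then 3 * i + tagged u else i + 4.

Lemma K33_1_part n (u : K33_1 n) : part (K33_1_label u) = minn (tag u) 2.
Proof.
case: u => i j; rewrite /K33_1_label /=.
have := ltn_ord j; rewrite /part; move: (nat_of_ord j) => l {j}.
by case: i => -[|[|i]] hi /=; case: l => [|[|[|l]]] //= _; rewrite ?addnS.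
Qed.

Lemma card_K33_1 n : #|K33_1 n| = n + 6.
Proof.
rewrite card_tagged sumnE big_map big_enum; under eq_bigr => i _ do rewrite card_ord.
rewrite (@big_ord_recl _ _ _ n.+1) (@big_ord_recl _ _ _ n) (eq_bigr (fun=> 1)) //.
by rewrite sum_nat_const card_ord /=; lia.
Qed.

Lemma K33_1_labelling n : labelling K33_1_rel (@K33_1_label n).
Proof.
have labI : injective (@K33_1_label n).
  move=> [i j] [i' j'] e.
  have ei : i = i'.
    apply: val_inj; move: e; rewrite /K33_1_label /=.
    have := ltn_ord j; have := ltn_ord j'; move: (nat_of_ord j) (nat_of_ord j') => l l'.
    by case: (ltnP i 2) => ?; case: (ltnP i' 2) => ?; lia.
  subst i'; congr existT; apply: val_inj.
  move: e; rewrite /K33_1_label /=.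
  have := ltn_ord j; have := ltn_ord j'; move: (nat_of_ord j) (nat_of_ord j') => l l'.
  by case: (ltnP i 2) => ?; lia.
split=> //.
- case=> i j; rewrite card_K33_1 /K33_1_label /=.
  have := ltn_ord j; have := ltn_ord i; move: (nat_of_ord i) (nat_of_ord j) => k l.
  by case: (ltnP k 2) => ?; lia.
- move=> u v; rewrite /K33_1_rel (inj_eq labI) !K33_1_part /= /multipartite_adj.
  have [-> | nuv] := eqVneq u v; first by rewrite eqxx.
  case: u v nuv => [i j] [i' j'] /=; have [ei|nii] := eqVneq i i'.
    subst i'; rewrite eqxx /= => nuv; apply/esym/negbTE; rewrite negbK.
    rewrite ltnNge leq_min leqnn andbT -ltnNge; apply: contraNT nuv; rewrite -leqNgt => i2.
    apply/eqP; congr existT; apply: val_inj => /=.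
    have := ltn_ord j; have := ltn_ord j'.
    move: (nat_of_ord j) (nat_of_ord j') => l l'; have -> : (i < 2) = false by rewrite ltnNge i2.
    by case: l l' => [|l] [|l'].
  move=> _; have : nat_of_ord i != i' by [].
  by move: (nat_of_ord i) (nat_of_ord i') => a b; rewrite /= => ab; apply/esym; lia.
Qed.

Lemma K_triangles N i j k : 2 < N ->
  neq_rel i j -> neq_rel j k -> neq_rel i k -> i < N -> j < N -> k < N ->
  exists l m o, [/\ [:: l; m; o] \in [:: [:: 0; 1; 2]], uniq [:: l; m; o],
      [/\ l < N, m < N & o < N] & perm_eq [:: 0; 0; 0] [:: 0; 0; 0]].
Proof.
by move=> N2 *; exists 0, 1, 2; split=> //; split=> //; lia.
Qed.

(** The corners of the former triangle are pairwise nonadjacent and are the only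
neighbours of the new vertex, so a triangle has at most one corner among them
and avoids the new vertex. *)
Lemma K_child_triangles N i j k : 6 < N ->
  K_child_rel i j -> K_child_rel j k -> K_child_rel i k -> i < N -> j < N -> k < N ->
  exists l m o, [/\ [:: l; m; o] \in [:: [:: 1; 4; 5]; [:: 4; 5; 6]],
      uniq [:: l; m; o], [/\ l < N, m < N & o < N] &
      perm_eq (map K_child_class [:: i; j; k]) (map K_child_class [:: l; m; o])].
Proof.
move=> N6; have bnd5 : [/\ 1 < N, 4 < N & 5 < N] by split; lia.
have bnd6 : [/\ 4 < N, 5 < N & 6 < N] by split; lia.
rewrite /K_child_rel /nabla_rel /neq_rel /K_child_class => + + + _ _ _.
by case: i => [|[|[|[|i]]]]; case: j => [|[|[|[|j]]]]; case: k => [|[|[|[|k]]]] //= ij jk ik;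
  (try by exists 1, 4, 5); exists 4, 5, 6.
Qed.

(** A triangle has at most one corner in each of the large parts. *)
Lemma K33_1_triangles N i j k : 6 < N ->
  K33_1_rel i j -> K33_1_rel j k -> K33_1_rel i k -> i < N -> j < N -> k < N ->
  exists l m o, [/\ [:: l; m; o] \in [:: [:: 0; 3; 6]; [:: 0; 6; 7];
                                        [:: 3; 6; 7]; [:: 6; 7; 8]],
      uniq [:: l; m; o], [/\ l < N, m < N & o < N] &
      perm_eq (map part [:: i; j; k]) (map part [:: l; m; o])].
Proof.
move=> N6 /andP[ij pij] /andP[jk pjk] /andP[ik pik] iN jN kN.
have partP x : [\/ part x = 0 /\ x < 3, part x = 1 /\ x < 6 | part x = 2 /\ 6 <= x].
  by rewrite /part; case: (ltnP x 3) => ?; [constructor 1|case: (ltnP x 6) => ?;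
    [constructor 2|constructor 3]].
case: (partP i) => -[pi i_]; case: (partP j) => -[pj j_]; case: (partP k) => -[pk k_];
  move: pij pjk pik; rewrite /= ?pi ?pj ?pk //= => _ _ _.
all: try by (exists 0, 3, 6; split=> //; split; lia).
all: try by (exists 0, 6, 7; split=> //; split; lia).
all: try by (exists 3, 6, 7; split=> //; split; lia).
by exists 6, 7, 8; split=> //; split; lia.
Qed.

Theorem theorem3 (R : realType) (n : nat) (hn : 0 < n) :
  [/\ in_O R n (complete_graph (n + 5)),
      (forall H : sgraph, child H (complete_graph (n + 5)) ->
         in_O R n H /\
         (forall H' : sgraph, child H' H -> in_O R n H')),
      in_O R n (K33_1 n)
    & (forall H : sgraph, child H (K33_1 n) -> in_O R n H)].
Proof.
have KL := complete_labelling (n + 5).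
have cK : #|complete_graph (n + 5)| = n + 5 by rewrite card_ord.
have ML := K33_1_labelling n; have cM := card_K33_1 n.
have tw0 : twin_classes neq_rel (minn 0) by apply: twin_classes_refine neq_twins _.
have twC s : 3 < s -> twin_classes K_child_rel (minn s).
  move=> s4; apply: twin_classes_refine (K_child_twins) _ => i j e.
  have class2 x : 3 < x -> K_child_class x = 2 by case: x => [|[|[|[|x]]]].
  by have [->//|ij] := eqVneq i j; rewrite !class2 //; lia.
have twM s : 5 < s -> twin_classes K33_1_rel (minn s).
  move=> s6; apply: twin_classes_refine K33_1_twins _ => i j e.
  have part2 x : 5 < x -> part x = 2 by case: x => [|[|[|[|[|[|x]]]]]].
  by have [->//|ij] := eqVneq i j; rewrite !part2 //; lia.
have symC : symmetric K_child_rel by apply/nabla_rel_sym/neq_sym.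
have irrC : irreflexive K_child_rel by apply/nabla_rel_irrefl/neq_irrefl.
split.
- by apply: (template_in_O R neq_sym neq_irrefl tw0 KL cK hn) complete_test.
- move=> H HK.
  have N2 : 2 < #|complete_graph (n + 5)| by rewrite cK; lia.
  have [l [m [o [tP bnd cH [h hL]]]]] := child_labelling neq_sym neq_irrefl neq_twins KL
    (fun i j k => @K_triangles _ i j k N2) HK.
  move: tP hL; rewrite !inE => /eqP[-> -> ->] hL {bnd}.
  have {}cH : #|H| = n + 6 by rewrite cH cK; lia.
  split.
    apply: (template_in_O R symC irrC (twC 4 isT) hL cH hn _ _ K_child_test) => //.
    by rewrite cH; lia.
  move=> H' HH'.
  have N6 : 6 < #|H| by rewrite cH; lia.
  have [l' [m' [o' [tP [lb mb ob] cH' [h' h'L]]]]] := child_labelling symC irrC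
    K_child_twins hL (fun i j k => @K_child_triangles _ i j k N6) HH'.
  have {}cH' : #|H'| = n + 7 by rewrite cH' cH; lia.
  move: tP h'L ob; rewrite !inE => /orP[]/eqP[-> -> ->] h'L ob.
    apply: (template_in_O R _ _ _ h'L cH' hn _ _ K_grandchild_test1) => //.
    + exact: nabla_rel_sym.
    + exact: nabla_rel_irrefl.
    + by apply: nabla_rel_twins => //; exact: twC.
    + by rewrite cH'; lia.
  apply: (template_in_O R _ _ _ h'L cH' hn _ _ K_grandchild_test2) => //.
  + exact: nabla_rel_sym.
  + exact: nabla_rel_irrefl.
  + by apply: nabla_rel_twins => //; exact: twC.
  + by rewrite cH'; lia.
- apply: (template_in_O R K33_1_rel_sym K33_1_rel_irrefl (twM 6 isT) ML cM hn _ _ K33_1_test) => //.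
  by rewrite cM; lia.
- move=> H HM.
  have N6 : 6 < #|K33_1 n| by rewrite cM; lia.
  have [l [m [o [tP [lb mb ob] cH [h hL]]]]] := child_labelling K33_1_rel_sym
    K33_1_rel_irrefl K33_1_twins ML (fun i j k => @K33_1_triangles _ i j k N6) HM.
  have {}cH : #|H| = n + 7 by rewrite cH cM; lia.
  have inO s : template_test (nabla_rel K33_1_rel [:: l; m; o]) s.+1 7 -> 5 < s ->
      all (fun x => x < s) [:: l; m; o] -> s.+1 <= #|H| -> in_O R n H.
    move=> test s6 ls sH; apply: (template_in_O R _ _ _ hL cH hn sH isT test).
    + exact/nabla_rel_sym/K33_1_rel_sym.
    + exact/nabla_rel_irrefl/K33_1_rel_irrefl.
    + by apply: nabla_rel_twins => //; exact: twM.
  move: tP lb mb ob inO; rewrite !inE cM => /or4P[]/eqP[-> -> ->] lb mb ob inO.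
  + by apply: (inO 7 K33_1_child_test1); rewrite // cH; lia.
  + by apply: (inO 8 K33_1_child_test2); rewrite // cH; lia.
  + by apply: (inO 8 K33_1_child_test3); rewrite // cH; lia.
  + by apply: (inO 9 K33_1_child_test4); rewrite // cH; lia.
Qed.
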